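(* Let $0<a\le b\le2$, let $t\mapsto H_t\in[a,b]$ be a continuous function on $\mathbf{R}$, let $0<\alpha\le2$ and $\lambda>0$. For $h>0$, $\mu>0$, $t\in\mathbf{R}$ write $$X_{h,\alpha,\mu}(t)=\int_{-\infty}^\infty\Big[e^{-\mu(t-x)_+}(t-x)_+^{h-\frac1\alpha}-e^{-\mu(-x)_+}(-x)_+^{h-\frac1\alpha}\Big]dZ_\alpha(x).$$ Then for any scale factor $c>0$, $$\big\{X_{H_{ct},\alpha,\lambda}(ct)\big\}_{t\in\mathbf{R}}\ \stackrel{fdd}{=}\ \big\{c^{H_{ct}}X_{H_{ct},\alpha,c\lambda}(t)\big\}_{t\in\mathbf{R}}.$$
   Context: Conventions: $(x)_+=\max\{x,0\}$ and $0^\gamma=0$ for all $\gamma\in\mathbf{R}$. $dZ_\alpha$ is an independently scattered symmetric $\alpha$-stable random measure on $\mathbf{R}$ with control measure $dx$, normalized so that $\mathbf{E}[e^{i\int f\,dZ_\alpha}]=\exp\{-\int_{-\infty}^\infty|f(x)|^\alpha dx\}$ for $f\in L^\alpha(\mathbf{R})$. The process $t\mapsto X_{H_t,\alpha,\lambda}(t)$ is the linear tempered multifractional stable motion (LTmFSM). $\stackrel{fdd}{=}$ denotes equality of all finite-dimensional distributions. *)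

(* Defs.v *)
From HB Require Import structures.
From mathcomp Require Import all_boot all_order all_algebra.
From mathcomp Require Import all_classical all_reals all_analysis.
From mathcomp Require Import complex.
Set Implicit Arguments.
Unset Strict Implicit.
Unset Printing Implicit Defensive.
Import Order.TTheory GRing.Theory Num.Theory.
Import numFieldNormedType.Exports HBSimple.
Local Open Scope classical_set_scope.
Local Open Scope ring_scope.

Section StableIntegral.
Context {R : realType} {d : measure_display} {T : measurableType d}.
Variable P : probability T R.

(* E[exp(iuY)]; the library has no integral of complex-valued functions, so the
   real and imaginary parts are integrated separately. *)
Definition char_fun (Y : {RV P >-> R}) (u : R) : R[i] :=
  Complex (fine 'E_P[fun w => cos (u * Y w)])
          (fine 'E_P[fun w => sin (u * Y w)]).

Definition is_SaS (alpha sigma : R) (Y : {RV P >-> R}) : Prop :=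
  forall u, char_fun Y u = (expR (- ((sigma * `|u|) `^ alpha)))%:C%C.

(* A finite family is mutually independent; subfamilies are covered by taking
   some of the B i to be the whole line. *)
Definition mutually_independent n (Y : 'I_n -> {RV P >-> R}) : Prop :=
  forall B : 'I_n -> set R, (forall i, measurable (B i)) ->
    P (\bigcap_i (Y i @^-1` B i)) = (\prod_(i < n) P (Y i @^-1` B i))%E.

Definition cvg_in_probability (Y_ : nat -> T -> R) (Y : T -> R) : Prop :=
  forall e : R, 0 < e ->
    P [set w | e <= `|Y_ n w - Y w|] @[n --> \oo] --> 0%E.

Definition finite_length (A : set R) : Prop :=
  measurable A /\ (lebesgue_measure A < +oo)%E.

(* A random measure is a function on all sets of reals, of which only the values
   on Borel sets of finite Lebesgue measure are relevant. *)
Implicit Type Z : set R -> {RV P >-> R}.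

Definition independently_scattered Z : Prop :=
  forall n (A : 'I_n -> set R), (forall i, finite_length (A i)) ->
    trivIset setT A -> mutually_independent (fun i => Z (A i)).

Definition as_sigma_additive Z : Prop :=
  forall A : nat -> set R, (forall k, measurable (A k)) -> trivIset setT A ->
    finite_length (\bigcup_k A k) ->
    {ae P, forall w,
      (\sum_(0 <= k < n) Z (A k) w) @[n --> \oo] --> Z (\bigcup_k A k) w}.

(* The term x = 0 vanishes, so only the support of s needs finite measure. *)
Definition simple_integral Z (s : {sfun R >-> R}) (w : T) : R :=
  \sum_(x \in range s) x * Z (s @^-1` [set x]) w.

Definition is_stable_integral Z (alpha : R) (f : R -> R) (Y : {RV P >-> R}) :
    Prop :=
  exists s : nat -> {sfun R >-> R},
    [/\ forall n, finite_length (s n @^-1` [set~ 0]),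
        (\int[lebesgue_measure]_x (`|f x - s n x| `^ alpha)%:E)%E
          @[n --> \oo] --> 0%E
      & cvg_in_probability (fun n => simple_integral Z (s n)) Y].

(* A version of the integral of f with respect to Z, and 0 if there is none. *)
Definition stable_integral Z (alpha : R) (f : R -> R) : {RV P >-> R} :=
  xget (cst 0 : {RV P >-> R}) [set Y | is_stable_integral Z alpha f Y].

Record stable_random_measure (alpha : R) Z : Prop := StableRandomMeasure {
  srm_scattered : independently_scattered Z;
  srm_additive : as_sigma_additive Z;
  srm_control : forall A, finite_length A ->
    is_SaS alpha (fine (lebesgue_measure A) `^ alpha^-1) (Z A);
  srm_normalized : forall f : R -> R, f \in Lfun lebesgue_measure alpha%:E ->
    char_fun (stable_integral Z alpha f) 1 =
    (expR (- fine (\int[lebesgue_measure]_x (`|f x| `^ alpha)%:E)%E))%:C%C }.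

(* (x)_+ ^ gamma with 0 ^ gamma = 0 for every gamma, whereas 0 `^ 0 = 1. *)
Definition pos_pow (x gamma : R) : R :=
  if Num.max x 0 == 0 then 0 else Num.max x 0 `^ gamma.

Definition tempered_kernel (alpha h mu t x : R) : R :=
  expR (- mu * Num.max (t - x) 0) * pos_pow (t - x) (h - alpha^-1) -
  expR (- mu * Num.max (- x) 0) * pos_pow (- x) (h - alpha^-1).

Definition tempered_stable_motion Z (h alpha mu t : R) : {RV P >-> R} :=
  stable_integral Z alpha (tempered_kernel alpha h mu t).

Definition same_fdd (X Y : R -> T -> R) : Prop :=
  forall n (t : n.-tuple R) (B : set (n.-tuple R)), measurable B ->
    P [set w | B [tuple X (tnth t i) w | i < n]] =
    P [set w | B [tuple Y (tnth t i) w | i < n]].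

End StableIntegral.

(* Main.v *)
Require Import Defs.
From HB Require Import structures.
From mathcomp Require Import all_boot all_order all_algebra.
From mathcomp Require Import all_classical all_reals all_analysis.
From mathcomp Require Import complex measurable_realfun ring lra.
Set Implicit Arguments.
Unset Strict Implicit.
Unset Printing Implicit Defensive.
Import Order.TTheory GRing.Theory Num.Theory.
Import numFieldNormedType.Exports HBSimple HBNNSimple.
Local Open Scope classical_set_scope.
Local Open Scope ring_scope.

(* The kernel is self-similar: the kernel with parameters (h, lambda) at (c t, c x)
   is c^(h - 1/alpha) times the kernel with parameters (h, c lambda) at (t, x). As
   Lebesgue measure scales by c, a linear combination of kernels on the left and
   the matching one on the right have the same integral of |.|^alpha, and this
   integral determines the characteristic function of the corresponding
   combination of stable integrals. So the joint characteristic functions agree.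
   Equal characteristic functions give equal laws because the bounded pointwise
   closure of the trigonometric functions is an algebra closed under exp, and
   contains the indicators of half-spaces as limits of
   exp (- exp (k N sin ((x - m) / N))) for N, then k, going to infinity. *)

(** * Bounded pointwise closure of a set of real functions *)

Section BoundedPointwiseClosure.
Context {R : realType} {S : Type}.
Implicit Types (G : set (S -> R)) (f g : S -> R).

(** [stable_integral] is selected by [xget] among its versions, so it is not visibly linear, and
    [srm_normalized] speaks of one selected integral at a time. Linearity is therefore proved for
    the relation [is_stable_integral], and the exponential formula is rederived for every integral
    in that sense: independent scattering gives it for simple functions, and limits in L^alpha and
    in probability carry it over. [srm_normalized] then serves to show that integrals exist. For
    alpha < 1 the triangle inequality of L^alpha fails; an elementary inequality with a constant
    close to 1 takes its place. Membership of the kernels in L^alpha is not decided: the two kernels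
    of one time point are integrable together, and otherwise both integrals take the default value
    0. The closure is one of functions, not of sets, because an equality of expectations survives
    each of its three constructors. It is used for laws, and also to pass from independent events to
    products of bounded functions. *)

Inductive bp_closure G : (S -> R) -> Prop :=
| bp_closure_sub f : G f -> bp_closure G f
| bp_closure_lin k f g :
    bp_closure G f -> bp_closure G g -> bp_closure G (fun x => k * f x + g x)
| bp_closure_lim (M : R) (f_ : nat -> S -> R) f :
    (forall n, bp_closure G (f_ n)) -> (forall n x, `|f_ n x| <= M) ->
    (forall x, f_ n x @[n --> \oo] --> f x) -> bp_closure G f.

Definition unif_bounded f := exists M : R, forall x, `|f x| <= M.

(** Products need only land in the closure, not in [G]: a product of two trigonometric functions is
    a linear combination of such functions. *)
Definition mul_closed_set G :=
  forall f g, G f -> G g -> bp_closure G (fun x => f x * g x).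

Lemma bp_closure_zero G f : bp_closure G f -> bp_closure G (cst 0).
Proof.
move=> Gf.
rewrite [cst 0](_ : _ = (fun x => -1 * f x + f x)); first exact: bp_closure_lin.
by apply/funext => x /=; rewrite mulN1r addNr.
Qed.

Lemma bp_closureZ G k f : bp_closure G (cst 0) -> bp_closure G f ->
  bp_closure G (fun x => k * f x).
Proof.
move=> G0 Gf; rewrite [X in bp_closure _ X](_ : _ = (fun x => k * f x + cst 0 x)).
  exact: bp_closure_lin.
by apply/funext => x /=; rewrite addr0.
Qed.

Lemma bp_closureD G f g : bp_closure G f -> bp_closure G g ->
  bp_closure G (fun x => f x + g x).
Proof.
move=> Gf Gg; rewrite [X in bp_closure _ X](_ : _ = (fun x => 1 * f x + g x)).
  exact: bp_closure_lin.
by apply/funext => x /=; rewrite mul1r.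
Qed.

Lemma bp_closureB G f g : bp_closure G f -> bp_closure G g ->
  bp_closure G (fun x => f x - g x).
Proof.
move=> Gf Gg; rewrite [X in bp_closure _ X](_ : _ = (fun x => -1 * g x + f x)).
  exact: bp_closure_lin.
by apply/funext => x /=; rewrite mulN1r addrC.
Qed.

Lemma bp_closure_bounded G : (forall f, G f -> unif_bounded f) ->
  forall f, bp_closure G f -> unif_bounded f.
Proof.
move=> bG f; elim=> {f} [f /bG //|k f g _ [M fM] _ [N gN]|M f_ f _ _ f_M f_f].
  exists (`|k| * M + N) => x; rewrite (le_trans (ler_normD _ _))// lerD//.
  by rewrite normrM ler_wpM2l.
exists M => x; have fx : `|f_ n x| @[n --> \oo] --> `|f x| by apply: cvg_norm; exact: f_f.
rewrite -(cvg_lim _ fx)//; apply: limr_le; first exact: cvgP fx.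
exact: nearW.
Qed.

(** Induction on [f] with [g] fixed and, for a generator [f], a second induction on [g]. In a limit
    step the bound on the other factor keeps the products uniformly bounded. *)
Lemma bp_closureM G : (forall f, G f -> unif_bounded f) ->
  mul_closed_set G ->
  forall f g, bp_closure G f -> bp_closure G g -> bp_closure G (fun x => f x * g x).
Proof.
move=> bG mG f g; have bclG := bp_closure_bounded bG.
elim=> {f} [f Gf|k f1 f2 Gf1 IH1 Gf2 IH2|M f_ f Gf_ IH f_M f_f] Gg; last 2 first.
- rewrite [X in bp_closure _ X](_ : _ =
      (fun x => k * (f1 x * g x) + f2 x * g x)).
    by apply: bp_closure_lin; [exact: IH1|exact: IH2].
  by apply/funext => x; rewrite mulrDl mulrA.
- have [N gN] := bclG _ Gg.
  apply: (@bp_closure_lim _ (M * N) (fun n x => f_ n x * g x)).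
  + by move=> n; exact: IH.
  + by move=> n x; rewrite normrM ler_pM.
  + by move=> x; apply: cvgM; [exact: f_f|exact: cvg_cst].
elim: Gg => {g} [g Gg|k g1 g2 Gg1 IH1 Gg2 IH2|M g_ g Gg_ IH g_M g_g].
- exact: mG.
- rewrite [X in bp_closure _ X](_ : _ =
      (fun x => k * (f x * g1 x) + f x * g2 x)).
    exact: bp_closure_lin.
  by apply/funext => x; rewrite mulrDr mulrCA.
- have [N fN] := bG _ Gf.
  apply: (@bp_closure_lim _ (N * M) (fun n x => f x * g_ n x)) => //.
  + by move=> n x; rewrite normrM ler_pM.
  + by move=> x; apply: cvgM; [exact: cvg_cst|exact: g_g].
Qed.

(** The partial sums of the exponential series lie in the closure and are all bounded by [expR M]
    when [M] bounds [f]. *)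
Lemma bp_closure_expR G : (forall f, G f -> unif_bounded f) ->
  mul_closed_set G -> bp_closure G (cst 1) ->
  forall f, bp_closure G f -> bp_closure G (fun x => expR (f x)).
Proof.
move=> bG mG G1 f Gf; have [M fM] := bp_closure_bounded bG Gf.
have GX n : bp_closure G (fun x => f x ^+ n).
  elim: n => [|n IH]; first by rewrite (_ : (fun _ => _) = cst 1).
  rewrite (_ : (fun _ => _) = (fun x => f x * f x ^+ n)); first exact: bp_closureM.
  by apply/funext => x; rewrite exprS.
have G0 := bp_closure_zero G1.
apply: (@bp_closure_lim _ (expR M) (fun n x => series (exp_coeff (f x)) n)).
- elim=> [|n IH].
    by rewrite (_ : (fun _ => _) = cst 0)//; apply/funext => x; rewrite seriesEnat/= big_geq.
  rewrite (_ : (fun _ => _) = (fun x => n`!%:R^-1 * f x ^+ n +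
      series (exp_coeff (f x)) n)); first exact: bp_closure_lin.
  by apply/funext => x; rewrite seriesSr addrC exp_coeffE.
- move=> n x; have M0 : 0 <= M by exact: le_trans (fM x).
  apply: (@le_trans _ _ (series (exp_coeff M) n)); last first.
    apply: nondecreasing_cvgn_le; last exact: is_cvg_series_exp_coeff.
    apply/nondecreasing_seqP => k; rewrite seriesSr lerDl.
    by rewrite exp_coeffE mulr_ge0// exprn_ge0.
  rewrite /series/= (le_trans (ler_norm_sum _ _ _))// ler_sum// => i _.
  by rewrite !exp_coeffE normrM ger0_norm// ler_wpM2l// normrX lerXn2r// nnegrE.
- move=> x; exact: is_cvg_series_exp_coeff.
Qed.

(** Products supply finite unions through 1_A + 1_B - 1_A 1_B, and a countable union is the bounded
    limit of its finite unions. Unlike in a Dynkin system, the sets may overlap. *)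
Lemma bp_closure_sigma_algebra G :
    (forall f, G f -> unif_bounded f) -> mul_closed_set G -> bp_closure G (cst 1) ->
  sigma_algebra setT [set A | bp_closure G \1_A].
Proof.
move=> bG mG G1; have G0 := bp_closure_zero G1.
split=> /= [|A GA|A GA].
- by rewrite indic0.
- rewrite setTD (_ : \1_ _ = (fun x => cst 1 x - \1_A x)).
    exact: bp_closureB.
  by apply/funext => x; rewrite !indicE in_setC; case: (_ \in _); rewrite ?subrr ?subr0.
have GU N : bp_closure G \1_(\bigcup_(k < N) A k).
  elim: N => [|N IH]; first by rewrite bigcup_mkord big_ord0 indic0.
  rewrite (_ : \1_ _ = fun x => \1_(\bigcup_(k < N) A k) x + \1_(A N) x -
     \1_(\bigcup_(k < N) A k) x * \1_(A N) x).
    apply: bp_closureB; first exact: bp_closureD.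
    exact: bp_closureM.
  apply/funext => x; rewrite bigcup_mkord big_ord_recr/= -bigcup_mkord.
  rewrite !indicE in_setU; case: (_ \in _); case: (_ \in _) => /=; ring.
apply: (@bp_closure_lim G 1 (fun N => \1_(\bigcup_(k < N) A k))) => //.
  by move=> N x; rewrite indicE; case: (_ \in _); rewrite ?normr1 ?normr0.
move=> x; apply: cvg_near_cst; rewrite !indicE.
have [[k _ Akx]|nAx] := pselect ((\bigcup_k A k) x).
  exists k.+1 => // N /= kN; have h1 : (\bigcup_k A k) x by exists k.
  have h2 : (\bigcup_(j < N) A j) x by exists k.
  by rewrite indicE (mem_set h1) (mem_set h2).
apply: nearW => N; rewrite indicE !memNset//.
by move=> [k _ Akx]; apply: nAx; exists k.
Qed.

End BoundedPointwiseClosure.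

(** * Indicators of Borel sets as bounded limits of trigonometric functions *)

Lemma cvg_mul_sin_harmonic {R : realType} (z : R) :
  n.+1%:R * sin (z / n.+1%:R) @[n --> \oo] --> z.
Proof.
(* The case 0 is set apart because the difference quotient of [sin] at 0 is evaluated along the
   points [z / n.+1%:R], which must not be 0. *)
have [->|z0] := eqVneq z 0.
  by under eq_fun do rewrite mul0r sin0 mulr0; exact: cvg_cst.
have [dsin dsinE] := is_derive_sin (0 : R).
move: dsin; rewrite /derivable => /cvg_ex[/= l dl].
have l1 : l = 1.
  rewrite -[RHS]cos0 -dsinE; apply/esym/cvg_lim => //; exact: dl.
move: dl; rewrite l1 => /cvgr_dnbhsP /(_ (fun n => z / n.+1%:R)) dl.
rewrite -[X in _ --> X]mulr1 (_ : (fun _ => _) = (fun n => z *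
    ((z / n.+1%:R)^-1 *: (sin (z / n.+1%:R *: 1 + 0) - sin 0)))).
  apply: cvgM; [exact: cvg_cst|apply: dl; split].
    by move=> n; rewrite mulf_neq0// invr_eq0.
  rewrite -[X in _ --> X](mulr0 z); apply: cvgM; first exact: cvg_cst.
  exact: cvg_harmonic.
apply/funext => n; rewrite sin0 subr0 addr0 /GRing.scale/= mulr1.
by rewrite invfM invrK mulrA mulrA divff// mul1r.
Qed.

Lemma normr_expRN_le1 {R : realType} (x : R) : `|expR (- expR x)| <= 1.
Proof.
by rewrite ger0_norm ?expR_ge0// -[leRHS](@expR0 R) ler_expR oppr_le0 expR_ge0.
Qed.

Section TrigClosure.
Context {R : realType} {n : nat}.
Implicit Types (th : 'I_n -> R) (x : n.-tuple R).

Definition tuple_dot th x : R := \sum_(i < n) th i * tnth x i.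

Definition trig_set : set (n.-tuple R -> R) :=
  [set f | exists th, f = (fun x => cos (tuple_dot th x)) \/
                      f = (fun x => sin (tuple_dot th x))].

Lemma tuple_dotD th th' x :
  tuple_dot (fun i => th i + th' i) x = tuple_dot th x + tuple_dot th' x.
Proof. by rewrite -big_split; apply: eq_bigr => i _ /=; rewrite mulrDl. Qed.

Lemma tuple_dotB th th' x :
  tuple_dot (fun i => th i - th' i) x = tuple_dot th x - tuple_dot th' x.
Proof. by rewrite -sumrB; apply: eq_bigr => i _ /=; rewrite mulrBl. Qed.

Lemma trig_cos th : trig_set (fun x => cos (tuple_dot th x)).
Proof. by exists th; left. Qed.

Lemma trig_sin th : trig_set (fun x => sin (tuple_dot th x)).
Proof. by exists th; right. Qed.

Lemma trig_bounded f : trig_set f -> unif_bounded f.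
Proof. by case=> th [] ->; exists 1 => x; rewrite ?cos_max ?sin_max. Qed.

Lemma trig_one : bp_closure trig_set (cst 1).
Proof.
apply: bp_closure_sub; exists (fun=> 0); left; apply/funext => x /=.
by rewrite /tuple_dot big1 ?cos0// => i _; rewrite mul0r.
Qed.

Lemma trig_zero : bp_closure trig_set (cst 0).
Proof. exact: bp_closure_zero trig_one. Qed.

Lemma trig_mul : mul_closed_set trig_set.
Proof.
(* All four cases below are product-to-sum formulas. *)
have half (f g h k : n.-tuple R -> R) (a b : R) : trig_set f -> trig_set g ->
    (forall x, h x * k x = a * f x + b * g x) ->
    bp_closure trig_set (fun x => h x * k x).
  move=> tf tg hk; rewrite (_ : (fun _ => _) = (fun x => a * f x + b * g x)).
    by apply: bp_closure_lin; [exact: bp_closure_sub|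
      apply: (bp_closureZ _ trig_zero); exact: bp_closure_sub].
  exact/funext.
move=> _ _ [th [] ->] [th' [] ->].
- apply: (half _ _ _ _ 2^-1 2^-1 (trig_cos (fun i => th i - th' i))
    (trig_cos (fun i => th i + th' i))) => x.
  by rewrite tuple_dotB tuple_dotD cosB cosD; field.
- apply: (half _ _ _ _ 2^-1 (- 2^-1) (trig_sin (fun i => th i + th' i))
    (trig_sin (fun i => th i - th' i))) => x.
  by rewrite tuple_dotB tuple_dotD sinB sinD; field.
- apply: (half _ _ _ _ 2^-1 2^-1 (trig_sin (fun i => th i - th' i))
    (trig_sin (fun i => th i + th' i))) => x.
  by rewrite tuple_dotB tuple_dotD sinB sinD; field.
- apply: (half _ _ _ _ 2^-1 (- 2^-1) (trig_cos (fun i => th i - th' i))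
    (trig_cos (fun i => th i + th' i))) => x.
  by rewrite tuple_dotB tuple_dotD cosB cosD; field.
Qed.

Lemma trig_shifted_sin (i : 'I_n) (m N : R) :
  bp_closure trig_set (fun x => sin ((tnth x i - m) / N)).
Proof.
pose th j := if j == i then N^-1 else 0.
have thE x : tuple_dot th x = tnth x i / N.
  rewrite /tuple_dot (bigD1 i)//= /th eqxx mulrC big1 ?addr0// => j /negbTE ->.
  by rewrite mul0r.
rewrite (_ : (fun _ => _) = fun x => cos (m / N) * sin (tuple_dot th x) +
    (- sin (m / N)) * cos (tuple_dot th x)).
  apply: bp_closure_lin; first exact/bp_closure_sub/trig_sin.
  apply: (bp_closureZ _ trig_zero); exact/bp_closure_sub/trig_cos.
by apply/funext => x; rewrite thE mulrBl sinB; ring.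
Qed.

Lemma trig_expR f : bp_closure trig_set f ->
  bp_closure trig_set (fun x => expR (f x)).
Proof. exact: bp_closure_expR trig_bounded trig_mul trig_one _. Qed.

(** The function [tnth x i - m] is unbounded and cannot itself lie in the closure. Its sine
    approximation is bounded for each [N], so [trig_expR] applies to it, and the outer exp (- exp)
    bounds the whole sequence by 1. *)
Lemma trig_gompertz (i : 'I_n) (m k : R) :
  bp_closure trig_set (fun x => expR (- expR (k * (tnth x i - m)))).
Proof.
apply: (@bp_closure_lim _ _ _ 1 (fun N x =>
    expR (- expR (k * (N.+1%:R * sin ((tnth x i - m) / N.+1%:R)))))).
- move=> N; apply: trig_expR; rewrite (_ : (fun _ => _) = (fun x =>
      (-1) * expR (k * (N.+1%:R * sin ((tnth x i - m) / N.+1%:R))))).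
    apply: (bp_closureZ _ trig_zero); apply: trig_expR.
    apply: (bp_closureZ _ trig_zero); apply: (bp_closureZ _ trig_zero).
    exact: trig_shifted_sin.
  by apply/funext => x; rewrite mulN1r.
- move=> N x; exact: normr_expRN_le1.
- move=> x; apply: continuous_cvg; first exact: continuous_expR.
  apply: cvgN; apply: continuous_cvg; first exact: continuous_expR.
  apply: cvgM; [exact: cvg_cst|exact: cvg_mul_sin_harmonic].
Qed.

Let step (z : R) : R := if z < 0 then 1 else if z == 0 then expR (-1) else 0.

Let cvg_step z : expR (- expR (N%:R * z)) @[N --> \oo] --> step z.
Proof.
rewrite /step; case: ltgtP => [z0|z0|->].
- rewrite -[X in _ --> X]expR0; apply: continuous_cvg; first exact: continuous_expR.
  rewrite -oppr0; apply: cvgN.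
  rewrite (_ : (fun _ => _) = (fun N => expR z ^+ N)).
    by apply: cvg_expr; rewrite ger0_norm ?expR_ge0// -expR0 ltr_expR.
  by apply/funext => N; rewrite mulrC expRM_natr.
(* As exp y >= y, the sequence lies below the geometric sequence exp (- N z). *)
- apply: (@squeeze_cvgr _ _ _ _ (cst 0) (fun N => expR (- z) ^+ N)).
  + apply: nearW => N; rewrite expR_ge0/= -expRM_natr ler_expR mulNr lerN2 mulrC.
    by rewrite (le_trans _ (expR_ge1Dx _))// lerDr.
  + exact: cvg_cst.
  + by apply: cvg_expr; rewrite ger0_norm ?expR_ge0// -expR0 ltr_expR oppr_lt0.
- by under eq_fun do rewrite mulr0 expR0; exact: cvg_cst.
Qed.

Let trig_step (i : 'I_n) (m : R) : bp_closure trig_set (fun x => step (tnth x i - m)).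
Proof.
apply: (@bp_closure_lim _ _ _ 1 (fun N x => expR (- expR (N%:R * (tnth x i - m))))).
- by move=> N; exact: trig_gompertz.
- move=> N x; exact: normr_expRN_le1.
- by move=> x; exact: cvg_step.
Qed.

(** Moving the threshold to m - 1/(N+1) removes the exceptional value exp (-1) of [step] at 0 in the
    limit: a coordinate >= m lies strictly above every moved threshold, a coordinate < m lies below
    all but finitely many. *)
Lemma trig_ray (i : 'I_n) (m : R) :
  bp_closure trig_set \1_[set x | tnth x i < m].
Proof.
apply: (@bp_closure_lim _ _ _ 1 (fun N x => step (tnth x i - (m - harmonic N)))).
- by move=> N; exact: trig_step.
- move=> N x; rewrite /step; case: ltgtP; rewrite ?normr1 ?normr0//.
  by rewrite ger0_norm ?expR_ge0// -[leRHS]expR0 ler_expR lerN10.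
- move=> x; rewrite indicE; case: (ltP (tnth x i) m) => xm.
    rewrite mem_set//=; apply: cvg_near_cst.
    have := @cvgr0_norm_lt _ _ _ _ _ _ (@cvg_harmonic R) (m - tnth x i).
    rewrite subr_gt0 => /(_ _ xm); apply: filterS => N.
    rewrite ger0_norm ?harmonic_ge0// /step => h.
    by rewrite subr_lt0 ltrBrDr addrC -ltrBrDr h.
  rewrite memNset/=; last by apply/negP; rewrite -leNgt.
  apply: cvg_near_cst; apply: nearW => N.
  have h : 0 < tnth x i - (m - @harmonic R N).
    by rewrite opprB addrCA -[ltLHS]addr0 ltr_leD ?harmonic_gt0 // subr_ge0.
  by rewrite /step ltNge (ltW h)/= gt_eqF.
Qed.

(** Minimality of the generated sigma-algebra is used twice: coordinate preimages generate the
    product structure, and open rays generate the Borel sets of each coordinate. *)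
Lemma trig_indic (B : set (n.-tuple R)) : measurable B ->
  bp_closure trig_set \1_B.
Proof.
have SA := bp_closure_sigma_algebra trig_bounded trig_mul trig_one.
suff: (@measurable _ (n.-tuple R)) `<=` [set B | bp_closure trig_set \1_B] by apply.
apply: smallest_sub => //; rewrite -bigcup_seq => C [i _ [A mA <-]] /=.
rewrite setTI; move: A mA.
suff: (@measurable _ R) `<=` [set A | bp_closure trig_set \1_((@tnth n R ^~ i) @^-1` A)] by [].
rewrite [X in X `<=` _](RGenInftyO.measurableE R).
apply: smallest_sub; last first.
  move=> _ [m ->] /=; rewrite (_ : _ @^-1` _ = [set x | tnth x i < m]).
    exact: trig_ray.
  by apply/seteqP; split => x /=; rewrite in_itv.
have [S0 SC SU] := SA; split=> /= [|A GA|A GA].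
- by rewrite preimage_set0.
- by rewrite setTD preimage_setC -setTD; exact: SC.
- by rewrite preimage_bigcup; exact: SU.
Qed.

End TrigClosure.

(** * Bounded measurable functions *)

Section BoundedMeasurable.
Context {R : realType} {d : measure_display} {T : measurableType d}.
Implicit Types f g : T -> R.

Definition bounded_measurable f := measurable_fun setT f /\ unif_bounded f.

Lemma bounded_measurable_cst k : bounded_measurable (cst k).
Proof. by split; [exact: measurable_cst|exists `|k|]. Qed.

Lemma bounded_measurableM f g : bounded_measurable f -> bounded_measurable g ->
  bounded_measurable (fun x => f x * g x).
Proof.
move=> [mf [M fM]] [mg [N gN]]; split; first exact: measurable_funM.
by exists (M * N) => x; rewrite normrM ler_pM.
Qed.

Lemma bounded_measurableD f g : bounded_measurable f -> bounded_measurable g ->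
  bounded_measurable (fun x => f x + g x).
Proof.
move=> [mf [M fM]] [mg [N gN]]; split; first exact: measurable_funD.
by exists (M + N) => x; rewrite (le_trans (ler_normD _ _))// lerD.
Qed.

Lemma bounded_measurableB f g : bounded_measurable f -> bounded_measurable g ->
  bounded_measurable (fun x => f x - g x).
Proof.
move=> [mf [M fM]] [mg [N gN]]; split; first exact: measurable_funB.
by exists (M + N) => x; rewrite (le_trans (ler_normB _ _))// lerD.
Qed.

Lemma bounded_measurable_indic (A : set T) : measurable A ->
  bounded_measurable \1_A.
Proof.
move=> mA; split; first exact: measurable_indic.
by exists 1 => x; rewrite indicE; case: (_ \in _); rewrite ?normr1 ?normr0.
Qed.

Lemma bounded_measurable_cos f : measurable_fun setT f ->
  bounded_measurable (fun x => cos (f x)).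
Proof.
move=> mf; split; last by exists 1 => x; exact: cos_max.
by apply: measurableT_comp => //; apply: continuous_measurable_fun; exact: continuous_cos.
Qed.

Lemma bounded_measurable_sin f : measurable_fun setT f ->
  bounded_measurable (fun x => sin (f x)).
Proof.
move=> mf; split; last by exists 1 => x; exact: sin_max.
by apply: measurableT_comp => //; apply: continuous_measurable_fun; exact: continuous_sin.
Qed.

Lemma bounded_measurable_comp d' (T' : measurableType d') (Y : T' -> T) f :
  measurable_fun setT Y -> bounded_measurable f ->
  measurable_fun setT (f \o Y) /\ unif_bounded (f \o Y).
Proof.
move=> mY [mf [M fM]]; split; first exact: measurableT_comp.
by exists M => x; exact: fM.
Qed.

(** Monotone approximation by simple functions requires a nonnegative function, hence the shift by
    the bound [M]; the approximations then stay between 0 and 2M. *)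
Lemma bounded_measurable_bp_closure f : bounded_measurable f ->
  bp_closure [set g | exists2 A, measurable A & g = \1_A] f.
Proof.
set G := [set g | _]; move=> [mf [M fM]].
have G0 : bp_closure G (cst 0).
  by apply: bp_closure_sub; exists set0 => //; rewrite indic0.
have G1 : bp_closure G (cst 1).
  by apply: bp_closure_sub; exists setT => //; rewrite indicT.
pose h x := (f x + M)%:E.
have mh : measurable_fun setT h.
  by apply/measurable_EFinP; apply: measurable_funD.
have h0 x : setT x -> (0 <= h x)%E.
  by move=> _; rewrite lee_fin -lerBlDr sub0r; have := fM x; rewrite ler_norml => /andP[].
pose s := nnsfun_approx measurableT mh.
rewrite (_ : f = fun x => (fun x => f x + M) x - M * cst 1 x); last first.
  by apply/funext => x /=; rewrite mulr1 addrK.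
apply: bp_closureB; last exact: bp_closureZ.
apply: (@bp_closure_lim _ _ _ (M + M) (fun n x => s n x)).
- move=> n.
  rewrite (_ : (s n : T -> R) =
    fun x => \sum_(y \in range (s n)) y * \1_(s n @^-1` [set y]) x); last first.
    by apply/funext => x; exact: fimfunE.
  rewrite (_ : (fun _ => _) = fun x => \sum_(y <- finmap.enum_fset (fset_set (range (s n))))
      y * \1_(s n @^-1` [set y]) x); last first.
    by apply/funext => x; rewrite fsbig_finite.
  elim: (finmap.enum_fset (fset_set (range (s n)))) => [|y r IH].
    by rewrite (_ : (fun _ => _) = cst 0)//; apply/funext => x; rewrite big_nil.
  rewrite (_ : (fun _ => _) = (fun x => y * \1_(s n @^-1` [set y]) x +
      \sum_(y <- r) y * \1_(s n @^-1` [set y]) x)).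
    apply: bp_closure_lin => //; apply: bp_closure_sub.
    by exists (s n @^-1` [set y]).
  by apply/funext => x; rewrite big_cons.
- move=> n x; rewrite ger0_norm//.
  have := le_approx n h0 (I : setT x); rewrite -nnsfun_approxE lee_fin => /le_trans; apply.
  by rewrite lerD2r; have := fM x; rewrite ler_norml => /andP[].
- move=> x; have := cvg_nnsfun_approx measurableT mh h0 (I : setT x).
  by rewrite /h => /fine_cvg.
Qed.

End BoundedMeasurable.

(** * Expectations of bounded functions *)

Section Expectation.
Context {R : realType} {d : measure_display} {T : measurableType d}.
Variable P : probability T R.
Implicit Types f g : T -> R.

Local Notation E f := (\int[P]_x f x).

Lemma bounded_measurable_integrable f : bounded_measurable f ->
  P.-integrable setT (EFin \o f).
Proof.
move=> [mf [M fM]]; apply: measurable_bounded_integrable => //.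
  by apply: le_lt_trans (probability_le1 P measurableT) _; rewrite ltry.
exists M; split; first exact: num_real.
by move=> N MN x _; rewrite /= (le_trans (fM x))// ltW.
Qed.

Lemma expectation_lin k f g : bounded_measurable f -> bounded_measurable g ->
  E (fun x => k * f x + g x) = k * E f + E g.
Proof.
move=> bf bg; rewrite RintegralD//.
- by rewrite RintegralZl//; exact: bounded_measurable_integrable.
- apply: bounded_measurable_integrable; apply: bounded_measurableM => //.
  exact: bounded_measurable_cst.
- exact: bounded_measurable_integrable.
Qed.

Lemma expectationZ k f : bounded_measurable f ->
  E (fun x => k * f x) = k * E f.
Proof. by move=> bf; rewrite RintegralZl//; exact: bounded_measurable_integrable. Qed.

Lemma expectationB f g : bounded_measurable f -> bounded_measurable g ->
  E (fun x => f x - g x) = E f - E g.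
Proof. by move=> bf bg; rewrite RintegralB//; exact: bounded_measurable_integrable. Qed.

Lemma expectation_cst k : E (cst k) = k.
Proof.
have -> : E (cst k) = k * fine (P setT) by exact: Rintegral_cst.
by rewrite probability_setT mulr1.
Qed.

Lemma bounded_convergence (M : R) (f_ : nat -> T -> R) f :
    (forall n, measurable_fun setT (f_ n)) -> measurable_fun setT f ->
    (forall n x, `|f_ n x| <= M) -> (forall x, f_ n x @[n --> \oo] --> f x) ->
  E (f_ n) @[n --> \oo] --> E f.
Proof.
move=> mf_ mf f_M f_f; apply: fine_cvg; rewrite fineK; last first.
  apply: integrable_fin_num => //; apply: bounded_measurable_integrable.
  (* The limit inherits boundedness from [bp_closure_bounded], with all bounded functions as
     generators. *)
  split => //; apply: (@bp_closure_bounded _ _ [set g | unif_bounded g]) => //.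
  apply: (bp_closure_lim (M := M) (f_ := f_)) => // n; apply: bp_closure_sub.
  by exists M.
apply: (@dominated_cvg _ _ _ _ _ _ _ _ (cst M%:E)) => //.
- by move=> n; exact/measurable_EFinP.
- by move=> x _; apply: cvg_EFin; [exact: nearW|exact: f_f].
- by apply: bounded_measurable_integrable; exact: bounded_measurable_cst.
- by move=> n x _; rewrite lee_fin.
Qed.

(** The weights let one induction serve two purposes: with both equal to 1 it compares the laws of
    [Y] and [Y']; with [Y] = [Y'] and [V'] constant it says that [V] is uncorrelated with functions
    of [Y]. *)
Lemma expectation_bp_closure (S : Type) (G : set (S -> R)) (Y Y' : T -> S)
    (V V' : T -> R) : bounded_measurable V -> bounded_measurable V' ->
    (forall f : S -> R, G f -> [/\ unif_bounded f, measurable_fun setT (f \o Y),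
       measurable_fun setT (f \o Y') &
       E (fun x => V x * f (Y x)) = E (fun x => V' x * f (Y' x))]) ->
  forall f : S -> R, bp_closure G f -> E (fun x => V x * f (Y x)) = E (fun x => V' x * f (Y' x)).
Proof.
move=> bV bV' GH.
have bG (f : S -> R) : G f -> unif_bounded f by move=> /GH[].
(* [S] carries no sigma-algebra, so measurability of the compositions has to be part of the
   induction. *)
suff H (f : S -> R) : bp_closure G f -> [/\ measurable_fun setT (f \o Y),
    measurable_fun setT (f \o Y') &
    E (fun x => V x * f (Y x)) = E (fun x => V' x * f (Y' x))].
  by move=> f /H[].
have bc (h : S -> R) (Z : T -> S) : unif_bounded h -> measurable_fun setT (h \o Z) ->
    bounded_measurable (h \o Z).
  by move=> [M hM] mh; split => //; exists M => x; exact: hM.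
elim=> {f} [f /GH[]//|k f g Gf [mf mf' Ef] Gg [mg mg' Eg]|M f_ f Gf_ IH f_M f_f].
  have bf := bp_closure_bounded bG Gf; have bg := bp_closure_bounded bG Gg.
  split.
  - by apply: measurable_funD => //; exact: measurable_funM.
  - by apply: measurable_funD => //; exact: measurable_funM.
  have lin (W : T -> R) (Z : T -> S) : bounded_measurable W ->
      measurable_fun setT (f \o Z) -> measurable_fun setT (g \o Z) ->
      E (fun x => W x * (k * f (Z x) + g (Z x))) =
      k * E (fun x => W x * f (Z x)) + E (fun x => W x * g (Z x)).
    move=> bW mfZ mgZ; rewrite -expectation_lin.
    - by apply: eq_Rintegral => x _; ring.
    - by apply: bounded_measurableM => //; exact: bc.
    - by apply: bounded_measurableM => //; exact: bc.
  by rewrite !lin// Ef Eg.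
have mlim (Z : T -> S) : (forall n, measurable_fun setT (f_ n \o Z)) ->
    measurable_fun setT (f \o Z).
  move=> mf_; apply: (@measurable_fun_cvg _ _ _ setT (fun n => f_ n \o Z)) => //.
  by move=> x _; exact: f_f.
have mY := mlim Y (fun n => let: And3 m _ _ := IH n in m).
have mY' := mlim Y' (fun n => let: And3 _ m _ := IH n in m).
split => //.
have lim (W : T -> R) (Z : T -> S) : bounded_measurable W ->
    (forall n, measurable_fun setT (f_ n \o Z)) -> measurable_fun setT (f \o Z) ->
    E (fun x => W x * f_ n (Z x)) @[n --> \oo] --> E (fun x => W x * f (Z x)).
  move=> [mW [N WN]] mf_ mf; apply: (@bounded_convergence (N * M)).
  - by move=> n; apply: measurable_funM => //; exact: mf_.
  - by apply: measurable_funM.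
  - by move=> n x; rewrite normrM ler_pM.
  - by move=> x; apply: cvgM; [exact: cvg_cst|exact: f_f].
have lY := lim V Y bV (fun n => let: And3 m _ _ := IH n in m) mY.
have lY' := lim V' Y' bV' (fun n => let: And3 _ m _ := IH n in m) mY'.
move: lY; rewrite (_ : (fun _ => _) = (fun n => E (fun x => V' x * f_ n (Y' x)))).
  by move=> lY; exact: (cvg_unique _ lY lY').
by apply/funext => n; have [] := IH n.
Qed.

End Expectation.

(** * Uniqueness theorem for characteristic functions *)

Section JointLaw.
Context {R : realType} {d : measure_display} {T : measurableType d}.
Variable P : probability T R.

Local Notation E f := (\int[P]_x f x).

Lemma expectation_indic (A : set T) : measurable A -> E \1_A = fine (P A).
Proof. by move=> mA; rewrite /Rintegral integral_indic// setIT. Qed.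

Lemma eq_joint_law n (Y Y' : T -> n.-tuple R) :
    measurable_fun setT Y -> measurable_fun setT Y' ->
    (forall th, E (fun x => cos (tuple_dot th (Y x))) =
                E (fun x => cos (tuple_dot th (Y' x))) /\
                E (fun x => sin (tuple_dot th (Y x))) =
                E (fun x => sin (tuple_dot th (Y' x)))) ->
  forall B, measurable B -> P (Y @^-1` B) = P (Y' @^-1` B).
Proof.
move=> mY mY' YY' B mB.
have mYB (Z : T -> n.-tuple R) : measurable_fun setT Z -> measurable (Z @^-1` B).
  by move=> mZ; rewrite -[X in measurable X]setTI; exact: mZ.
rewrite -[LHS]fineK ?fin_num_measure//; last exact: mYB.
rewrite -[RHS]fineK ?fin_num_measure//; last exact: mYB.
congr (_%:E); rewrite -!expectation_indic; [|exact: mYB|exact: mYB].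
have mdot (Z : T -> n.-tuple R) th : measurable_fun setT Z ->
    measurable_fun setT (fun x => tuple_dot th (Z x)).
  move=> mZ; apply: measurable_sum => i; apply: measurable_funM => //.
  exact: (measurableT_comp (measurable_tnth i) mZ).
have b1 : bounded_measurable (cst 1 : T -> R) by exact: bounded_measurable_cst.
have H (f : n.-tuple R -> R) : trig_set f -> [/\ unif_bounded f,
    measurable_fun setT (f \o Y), measurable_fun setT (f \o Y') &
    E (fun x => (cst 1 : T -> R) x * f (Y x)) = E (fun x => (cst 1 : T -> R) x * f (Y' x))].
  have e1 (Z : T -> n.-tuple R) : E (fun x => (cst 1 : T -> R) x * f (Z x)) = E (f \o Z).
    by apply: eq_Rintegral => x _ /=; rewrite mul1r.
  move=> tf; rewrite !e1; split; first exact: trig_bounded.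
  - by case: tf => th [] ->; [have [] := bounded_measurable_cos (mdot _ th mY)|
      have [] := bounded_measurable_sin (mdot _ th mY)].
  - by case: tf => th [] ->; [have [] := bounded_measurable_cos (mdot _ th mY')|
      have [] := bounded_measurable_sin (mdot _ th mY')].
  - by case: tf => th [] ->; have [] := YY' th.
have := expectation_bp_closure b1 b1 H (trig_indic mB).
have e2 (Z : T -> n.-tuple R) : E (fun x => (cst 1 : T -> R) x * \1_B (Z x)) = E \1_(Z @^-1` B).
  by apply: eq_Rintegral => x _ /=; rewrite mul1r !indicE.
by rewrite !e2.
Qed.

End JointLaw.

(** * Characteristic function of a sum of independent symmetric variables *)

Section Independence.
Context {R : realType} {d : measure_display} {T : measurableType d}.
Variables (P : probability T R) (n : nat) (Y : 'I_n -> {RV P >-> R}).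
Hypothesis indY : mutually_independent Y.

Local Notation E f := (\int[P]_x f x).

Let tail (j : nat) (B : 'I_n -> set R) (x : T) : R :=
  \prod_(i < n | (j <= i)%N) \1_(B i) (Y i x).

(** Independence of [W] from the variables of index at least [j], tested on boxes and on the mean of
    [W] only. The condition is linear in [W], so the sigma-algebra generated by the earlier
    variables never has to appear. *)
Let free_of_tail (j : nat) (W : T -> R) := bounded_measurable W /\
  forall B, (forall i, measurable (B i)) ->
    E (fun x => W x * tail j B x) =
    E W * \prod_(i < n | (j <= i)%N) E (fun x => \1_(B i) (Y i x)).

Let bounded_measurable_tail j B : (forall i, measurable (B i)) ->
  bounded_measurable (tail j B).
Proof.
move=> mB; rewrite /tail; elim: (index_enum _) => [|i r IH].
  rewrite (_ : (fun _ => _) = cst 1); first exact: bounded_measurable_cst.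
  by apply/funext => x; rewrite big_nil.
have [ji|ji] := boolP (j <= i)%N; last first.
  by apply: eq_ind IH _ _; apply/funext => x; rewrite big_cons (negbTE ji).
rewrite (_ : (fun _ => _) = (fun x => \1_(B i) (Y i x) *
    \prod_(i <- r | (j <= i)%N) \1_(B i) (Y i x))); last first.
  by apply/funext => x; rewrite big_cons ji.
apply: bounded_measurableM => //.
exact: (bounded_measurable_comp _ (bounded_measurable_indic (mB i))).
Qed.

Let free_of_tail_lin j k W W' : free_of_tail j W -> free_of_tail j W' ->
  free_of_tail j (fun x => k * W x + W' x).
Proof.
move=> [bW WE] [bW' WE']; split.
  apply: bounded_measurableD => //; apply: bounded_measurableM => //.
  exact: bounded_measurable_cst.
move=> B mB; rewrite expectation_lin// mulrDl -mulrA -WE// -WE'//.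
rewrite -expectation_lin; last 2 first.
- by apply: bounded_measurableM => //; exact: bounded_measurable_tail.
- by apply: bounded_measurableM => //; exact: bounded_measurable_tail.
by apply: eq_Rintegral => x _; ring.
Qed.

(** When [f] is an indicator, it becomes the [j]-th side of the box in [tail j]; the bounded
    pointwise closure extends this to bounded measurable [f]. *)
Let free_of_tail_mul (j : 'I_n) W f : free_of_tail j W -> bounded_measurable f ->
  free_of_tail j.+1 (fun x => W x * f (Y j x)) /\
  E (fun x => W x * f (Y j x)) = E W * E (fun x => f (Y j x)).
Proof.
move=> [bW WE] bf.
have bfY : bounded_measurable (fun x => f (Y j x)).
  exact: (bounded_measurable_comp _ bf).
have tailE B x : tail j B x = \1_(B j) (Y j x) * tail j.+1 B x.
  rewrite /tail (bigD1 j)//=; congr (_ * _); apply: eq_bigl => i.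
  by rewrite ltn_neqAle eq_sym andbC.
have H B : (forall i, measurable (B i)) ->
    E (fun x => (W x * tail j.+1 B x) * f (Y j x)) =
    E W * \prod_(i < n | (j < i)%N) E (fun x => \1_(B i) (Y i x)) *
    E (fun x => f (Y j x)).
  move=> mB; set p := \prod_(_ < n | _) _.
  have bV : bounded_measurable (fun x => W x * tail j.+1 B x).
    by apply: bounded_measurableM => //; exact: bounded_measurable_tail.
  have bV' : bounded_measurable (cst (E W * p) : T -> R).
    exact: bounded_measurable_cst.
  rewrite -expectationZ//.
  apply: (expectation_bp_closure bV bV' _ (bounded_measurable_bp_closure bf)).
  move=> _ [A mA ->].
  have [mA1 bA] := @bounded_measurable_indic R _ _ A mA.
  have mAY : measurable_fun setT ((\1_A : R -> R) \o Y j) by exact: measurableT_comp.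
  split=> //.
  pose B' i := if i == j then A else B i.
  have mB' i : measurable (B' i) by rewrite /B'; case: ifP.
  have tailB' x : tail j.+1 B x = tail j.+1 B' x.
    apply: eq_bigr => i ji; rewrite /B' ifF//; apply/negbTE.
    by apply: contraTneq ji => ->; rewrite ltnn.
  transitivity (E (fun x => W x * tail j B' x)).
    by apply: eq_Rintegral => x _; rewrite tailE -tailB' /B' eqxx; ring.
  rewrite WE// expectationZ; last exact: (bounded_measurable_comp _ (conj mA1 bA)).
  rewrite (bigD1 j)//= {1}/B' eqxx -mulrA; congr (_ * _); rewrite mulrC.
  congr (_ * _); rewrite /p; apply: eq_big => [i|i].
    by rewrite ltn_neqAle eq_sym andbC.
  by move=> /andP[_ /negbTE ij]; rewrite /B' ij.
have EWf : E (fun x => W x * f (Y j x)) = E W * E (fun x => f (Y j x)).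
  (* When every side is the whole line, the tail is 1. *)
  have := H (fun=> setT) (fun=> measurableT).
  rewrite big1 ?mulr1 => [<-|i _].
    by apply: eq_Rintegral => x _; rewrite /tail big1 ?mulr1// => i _; rewrite indicT.
  by rewrite indicT; exact: expectation_cst.
split=> //; split; first exact: bounded_measurableM.
move=> B mB; rewrite EWf mulrAC -H//.
by apply: eq_Rintegral => x _; ring.
Qed.

(** Variables are added one at a time by the addition formulas, and every term containing the sine
    of the new variable has mean 0. Cosine and sine of the partial sum go through the induction
    together, as each new formula involves both. *)
Lemma independent_trig_sum (u : 'I_n -> R) :
    (forall i, E (fun x => sin (u i * Y i x)) = 0) ->
  E (fun x => cos (\sum_(i < n) u i * Y i x)) =
    \prod_(i < n) E (fun x => cos (u i * Y i x)) /\
  E (fun x => sin (\sum_(i < n) u i * Y i x)) = 0.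
Proof.
move=> sin0i; pose S j x := \sum_(i < n | (i < j)%N) u i * Y i x.
suff H j : (j <= n)%N -> [/\ free_of_tail j (fun x => cos (S j x)),
    free_of_tail j (fun x => sin (S j x)),
    E (fun x => cos (S j x)) =
      \prod_(i < n | (i < j)%N) E (fun x => cos (u i * Y i x)) &
    E (fun x => sin (S j x)) = 0].
  have SE x : \sum_(i < n) u i * Y i x = S n x by apply: eq_bigl => i; rewrite ltn_ord.
  have [_ _ cosn sinn] := H n (leqnn n).
  split.
    transitivity (E (fun x => cos (S n x))); first by apply: eq_Rintegral => x _; rewrite SE.
    by rewrite cosn; apply: eq_bigl => i; rewrite ltn_ord.
  by rewrite -[RHS]sinn; apply: eq_Rintegral => x _; rewrite SE.
have S0 x : S 0 x = 0 by rewrite /S big1.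
have tail0 B x : tail 0 B x = \1_(\bigcap_i (Y i @^-1` B i)) x.
  rewrite /tail indicE; have [Yx|nYx] := pselect ((\bigcap_i (Y i @^-1` B i)) x).
    by rewrite mem_set// big1// => i _; rewrite indicE mem_set//; exact: Yx.
  rewrite memNset//.
  have [i Bi] : exists i, ~ B i (Y i x).
    by apply/not_existsP => h; apply: nYx => i _; apply: contrapT; exact: h.
  by rewrite (bigD1 i)//= indicE memNset// mul0r.
elim: j => [_|j IH jn].
  have Ecst (f : T -> R) (k : R) : (forall x, f x = k) -> E f = k.
    by move=> fk; rewrite -[RHS](expectation_cst P); apply: eq_Rintegral => x _.
  split.
  - split; first by under eq_fun do rewrite S0; exact: bounded_measurable_cst.
    move=> B mB; rewrite (@Ecst (fun x => cos (S 0 x)) 1) => [|x]; last by rewrite S0 cos0.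
    rewrite mul1r; transitivity (E \1_(\bigcap_i (Y i @^-1` B i))).
      by apply: eq_Rintegral => x _; rewrite S0 cos0 mul1r tail0.
    have mYB i : measurable (Y i @^-1` B i).
      by rewrite -[X in measurable X]setTI; exact: measurable_funPT.
    rewrite expectation_indic; last first.
      by apply: fin_bigcap_measurable => //; exact: finite_finset.
    (* Mutual independence enters here, for the full box; later steps only peel off its sides. *)
    rewrite indY//.
    transitivity (\prod_(i < n) fine (P (Y i @^-1` B i))).
      rewrite (eq_bigr (fun i => (fine (P (Y i @^-1` B i)))%:E)) => [|i _]; last first.
        by rewrite fineK// fin_num_measure.
      by rewrite prodEFin.
    apply: eq_bigr => i _; rewrite -expectation_indic//.
  - split; first by under eq_fun do rewrite S0; exact: bounded_measurable_cst.
    move=> B mB; rewrite (@Ecst (fun x => sin (S 0 x)) 0) => [|x]; last by rewrite S0 sin0.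
    by rewrite mul0r; apply: Ecst => x; rewrite S0 sin0 mul0r.
  - by rewrite big1//; apply: Ecst => x; rewrite S0 cos0.
  - by apply: Ecst => x; rewrite S0 sin0.
have [fc fs Ec Es] := IH (ltnW jn).
pose k := Ordinal jn.
have SS x : S j.+1 x = u k * Y k x + S j x.
  rewrite /S (bigD1 k)//=; congr (_ + _); apply: eq_bigl => i.
  by rewrite ltnS andbC ltn_neqAle.
have bc : bounded_measurable (fun y => cos (u k * y)).
  by apply: bounded_measurable_cos; exact: measurable_funM.
have bs : bounded_measurable (fun y => sin (u k * y)).
  by apply: bounded_measurable_sin; exact: measurable_funM.
have [cc Ecc] := free_of_tail_mul (j := k) fc bc.
have [cs Ecs] := free_of_tail_mul (j := k) fc bs.
have [sc Esc] := free_of_tail_mul (j := k) fs bc.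
have [ss Ess] := free_of_tail_mul (j := k) fs bs.
have cosS : (fun x => cos (S j.+1 x)) = (fun x => -1 * (sin (S j x) * sin (u k * Y k x)) +
    cos (S j x) * cos (u k * Y k x)).
  by apply/funext => x; rewrite SS cosD; ring.
have sinS : (fun x => sin (S j.+1 x)) = (fun x => 1 * (sin (S j x) * cos (u k * Y k x)) +
    cos (S j x) * sin (u k * Y k x)).
  by apply/funext => x; rewrite SS sinD; ring.
rewrite cosS sinS; split.
- exact: free_of_tail_lin.
- exact: free_of_tail_lin.
- rewrite expectation_lin; [|exact: ss.1|exact: cc.1].
  rewrite Ess Ecc sin0i mulr0 mulr0 add0r [RHS](bigD1 k)//= mulrC Ec; congr (_ * _).
  by apply: eq_bigl => i; rewrite ltnS andbC ltn_neqAle.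
- rewrite expectation_lin; [|exact: sc.1|exact: cs.1].
  by rewrite Esc Ecs sin0i Es !(mulr0, mul0r, addr0).
Qed.

End Independence.

(** * Finite additivity of the random measure and linearity of the simple integral *)

Section RandomMeasure.
Context {R : realType} {d : measure_display} {T : measurableType d}.
Variables (P : probability T R) (Z : set R -> {RV P >-> R}).
Hypothesis Z_additive : as_sigma_additive Z.

Lemma finite_length0 : finite_length (set0 : set R).
Proof. by split => //; rewrite measure0. Qed.

Lemma finite_length_sub (A B : set R) : measurable A -> A `<=` B ->
  finite_length B -> finite_length A.
Proof.
move=> mA AB [mB lB]; split => //; apply: le_lt_trans lB.
by apply: le_measure => //; rewrite inE.
Qed.

Lemma finite_lengthU (A B : set R) : finite_length A -> finite_length B ->
  finite_length (A `|` B).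
Proof.
move=> [mA lA] [mB lB]; split; first exact: measurableU.
apply: (@le_lt_trans _ _ (lebesgue_measure A + lebesgue_measure B)%E).
  exact: measureU2.
exact: lte_add_pinfty.
Qed.

(** For a constant sequence of empty sets the partial sums n Z(set0) converge, so their increment
    Z(set0) must be 0. *)
Lemma random_measure_set0 : {ae P, forall w, Z set0 w = 0}.
Proof.
have t0 : trivIset setT (fun _ : nat => set0 : set R).
  by apply/trivIsetP => i j _ _ _; rewrite setI0.
have := Z_additive (A := fun=> set0) (fun=> measurable0) t0.
rewrite bigcup0// => /(_ finite_length0); apply: filterS => w Zw.
have : (\sum_(0 <= k < n.+1) Z set0 w - \sum_(0 <= k < n) Z set0 w) @[n --> \oo]
    --> Z set0 w - Z set0 w.
  by apply: cvgB => //; rewrite (cvg_shiftS (fun n => \sum_(0 <= k < n) Z set0 w)).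
under eq_fun do rewrite big_nat_recr//= addrAC subrr add0r.
by rewrite subrr => /(cvg_lim (@Rhausdorff R)) <-; rewrite lim_cst.
Qed.

Lemma random_measureU (A B : set R) : finite_length A -> finite_length B ->
  A `&` B = set0 -> {ae P, forall w, Z (A `|` B) w = Z A w + Z B w}.
Proof.
move=> fA fB AB; have lU := finite_lengthU fA fB.
have [mA _] := fA; have [mB _] := fB.
(* The pair is continued by empty sets; the partial sums are stationary from index 2 on wherever
   Z(set0) is 0. *)
rewrite -bigcup2E in lU *.
have mAB k : measurable (bigcup2 A B k).
  by case: k => [|[|k]] /=; [exact: mA|exact: mB|exact: measurable0].
have tAB : trivIset setT (bigcup2 A B).
  apply/trivIsetP => -[|[|i]] [|[|j]] _ _ //= _; rewrite ?set0I ?setI0//.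
  by rewrite setIC.
have := Z_additive mAB tAB lU; apply: filterS2 random_measure_set0 => w Z0 Zw.
apply: (cvg_unique (@Rhausdorff R) Zw); apply: cvg_near_cst.
exists 2%N => // n /=; case: n => [|[|n]]// _.
rewrite big_nat_recl// big_nat_recl//= big1 ?addr0//.
Qed.

Lemma random_measure_big (I : eqType) (r : seq I) (A : I -> set R) : uniq r ->
    (forall i, i \in r -> finite_length (A i)) ->
    (forall i j, i \in r -> j \in r -> i != j -> A i `&` A j = set0) ->
  {ae P, forall w, Z (\big[setU/set0]_(i <- r) A i) w = \sum_(i <- r) Z (A i) w}.
Proof.
elim: r => [_ _ _|i r IH /= /andP[ir ur] fA dA].
  apply: filterS random_measure_set0 => w Z0; rewrite !big_nil//.
have fr : finite_length (\big[setU/set0]_(j <- r) A j).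
  elim: r fA {IH ir ur dA} => [_|j r IHr fA].
    by rewrite big_nil; exact: finite_length0.
  rewrite big_cons; apply: finite_lengthU.
    by apply: fA; rewrite !inE eqxx orbT.
  by apply: IHr => k; rewrite inE => kr; apply: fA; rewrite !inE; case/orP: kr => ->; rewrite ?orbT.
have fi : finite_length (A i) by apply: fA; rewrite inE eqxx.
have di : A i `&` \big[setU/set0]_(j <- r) A j = set0.
  rewrite big_seq; elim/big_ind : _ => [|B C iB iC|j jr]; first by rewrite setI0.
    by rewrite setIUr iB iC setU0.
  by apply: dA; rewrite ?inE ?eqxx ?jr ?orbT//; apply: contraNneq ir => ->.
have {}IH := IH ur (fun j jr => fA j (mem_behead (s := i :: r) jr))
  (fun j k jr kr => dA j k (mem_behead (s := i :: r) jr) (mem_behead (s := i :: r) kr)).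
apply: filterS2 (random_measureU fi fr di) IH => w Zw IH.
by rewrite !big_cons Zw IH.
Qed.

Lemma ae_seq (I : eqType) (r : seq I) (Q : I -> T -> Prop) :
    (forall i, i \in r -> {ae P, forall w, Q i w}) ->
  {ae P, forall w, forall i, i \in r -> Q i w}.
Proof.
elim: r => [|i r IH] Qr; first exact: aeW.
apply: filterS2 (Qr i (mem_head _ _)) (IH (fun j jr => Qr j (mem_behead (s := i :: r) jr))).
by move=> w Qi Qrw j; rewrite inE => /predU1P[->//|]; exact: Qrw.
Qed.

(** [simple_integral] is tied to the level sets of [s], while adding simple functions requires finer
    partitions. The identity is almost sure because additivity of [Z] is. *)
Lemma simple_integral_partition (I : choiceType) (r : seq I) (A : I -> set R)
    (v : I -> R) (s : {sfun R >-> R}) : uniq r ->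
    (forall i, i \in r -> measurable (A i)) ->
    (forall i j, i \in r -> j \in r -> i != j -> A i `&` A j = set0) ->
    (forall x, exists2 i, i \in r & A i x) ->
    (forall i x, i \in r -> A i x -> s x = v i) ->
    finite_length (s @^-1` [set~ 0]) ->
  {ae P, forall w, simple_integral Z s w = \sum_(i <- r) v i * Z (A i) w}.
Proof.
move=> ur mA dA cA vA fs.
(* A part of infinite length can only carry the value 0, and then contributes to neither side. *)
have fA i : i \in r -> v i != 0 -> finite_length (A i).
  move=> ir vi0; apply: finite_length_sub fs; first exact: mA.
  by move=> x Aix /=; rewrite (vA i)//; exact/eqP.
have preE z : s @^-1` [set z] = \big[setU/set0]_(i <- [seq i <- r | v i == z]) A i.
  rewrite -bigcup_seq; apply/seteqP; split => [x /= sx|x [j] /=].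
    have [i ir Aix] := cA x; exists i => //=.
    by rewrite mem_filter ir andbT -(vA _ _ ir Aix) sx.
  by rewrite mem_filter => /andP[/eqP <- jr]; exact: vA.
have level z : {ae P, forall w, z * Z (s @^-1` [set z]) w =
    \sum_(i <- r | v i == z) v i * Z (A i) w}.
  have [->|z0] := eqVneq z 0.
    by apply: aeW => w; rewrite mul0r big1// => i /eqP ->; rewrite mul0r.
  have h1 i : i \in [seq i <- r | v i == z] -> finite_length (A i).
    by rewrite mem_filter => /andP[/eqP viz ir]; apply: fA; rewrite ?viz.
  have h2 i j : i \in [seq i <- r | v i == z] -> j \in [seq i <- r | v i == z] ->
      i != j -> A i `&` A j = set0.
    by rewrite !mem_filter => /andP[_ ir] /andP[_ jr]; exact: dA.
  have := @random_measure_big _ [seq i <- r | v i == z] A (filter_uniq _ ur) h1 h2.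
  apply: filterS => w; rewrite preE => ->.
  by rewrite big_filter mulr_sumr; apply: eq_bigr => i /eqP ->.
(* A value [v i] that [s] does not attain forces [A i] to be empty; [Z] then vanishes on it almost
   surely. *)
have ranged : {ae P, forall w, forall i, i \in r -> ~ range s (v i) -> Z (A i) w = 0}.
  apply: ae_seq => i ir; have [vi|vi] := pselect (range s (v i)).
    exact: aeW.
  apply: filterS random_measure_set0 => w Z0 _; rewrite (_ : A i = set0)//.
  by apply/seteqP; split => // x Aix; apply: vi; exists x => //; exact: vA.
have := @ae_seq _ (finmap.enum_fset (fset_set (range s))) _ (fun z _ => level z).
apply: filterS2 ranged => w Zw0 lev.
rewrite /simple_integral fsbig_finite//= (eq_big_seq _ lev).
rewrite (exchange_big_dep predT)//= [RHS]big_seq [LHS]big_seq.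
apply: eq_bigr => i ir; have [vi|vi] := pselect (range s (v i)).
  have vS : v i \in finmap.enum_fset (fset_set (range s)).
    by have := in_fset_set (fimfunP s) (v i); rewrite [RHS]mem_set.
  rewrite -big_filter (_ : [seq _ <- _ | _] = [:: v i]) ?big_seq1//.
  rewrite (@eq_filter _ _ (pred1 (v i))); last by move=> z; rewrite /= eq_sym.
  by rewrite filter_pred1_uniq//; exact: finmap.fset_uniq.
rewrite Zw0// !mulr0 big1//.
Qed.

(** All three functions are constant on the cells of the common refinement of the level sets of [s]
    and [s']. Cells for pairs of values that never occur together are empty. *)
Lemma simple_integral_lin (k : R) (s s' r : {sfun R >-> R}) :
    finite_length (s @^-1` [set~ 0]) -> finite_length (s' @^-1` [set~ 0]) ->
    finite_length (r @^-1` [set~ 0]) ->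
    (forall x, r x = k * s x + s' x) ->
  {ae P, forall w, simple_integral Z r w =
     k * simple_integral Z s w + simple_integral Z s' w}.
Proof.
move=> fs fs' fr rE.
pose S := [seq (x, y) | x <- finmap.enum_fset (fset_set (range s)),
    y <- finmap.enum_fset (fset_set (range s'))].
pose A (p : R * R) := s @^-1` [set p.1] `&` s' @^-1` [set p.2].
have uS : uniq S by apply: allpairs_uniq; [exact: finmap.fset_uniq..|move=> [x y] [x' y']].
have mA i : i \in S -> measurable (A i).
  by move=> _; apply: measurableI; exact: measurable_sfunP.
have dA i j : i \in S -> j \in S -> i != j -> A i `&` A j = set0.
  move=> _ _; apply: contraNeq => /set0P[x [[/= h1 h2] [h3 h4]]].
  by case: i j h1 h2 h3 h4 => [? ?] [? ?] /= <- <- <- <-.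
have cA x : exists2 i, i \in S & A i x.
  exists (s x, s' x) => //; apply/allpairsP; exists (s x, s' x); split => //=.
    by have := in_fset_set (fimfunP s) (s x); rewrite [RHS]mem_set//; exists x.
  by have := in_fset_set (fimfunP s') (s' x); rewrite [RHS]mem_set//; exists x.
have pr : {ae P, forall w, simple_integral Z r w = \sum_(i <- S) (k * i.1 + i.2) * Z (A i) w}.
  apply: simple_integral_partition => // i x _ [/= <- <-]; exact: rE.
have ps : {ae P, forall w, simple_integral Z s w = \sum_(i <- S) i.1 * Z (A i) w}.
  by apply: simple_integral_partition => // i x _ [/= <-].
have ps' : {ae P, forall w, simple_integral Z s' w = \sum_(i <- S) i.2 * Z (A i) w}.
  by apply: simple_integral_partition => // i x _ [/= _ <-].
apply: filterS3 pr ps ps' => w -> -> ->.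
rewrite mulr_sumr -big_split/=; apply: eq_bigr => i _; ring.
Qed.

End RandomMeasure.

(** * Characteristic function of the integral of a simple function *)

Section StableSimpleIntegral.
Context {R : realType} {d : measure_display} {T : measurableType d}.
Variables (P : probability T R) (alpha : R) (Z : set R -> {RV P >-> R}).
Hypotheses (alpha_gt0 : 0 < alpha) (Z_stable : stable_random_measure alpha Z).

Local Notation E f := (\int[P]_x f x).
Local Notation mu := (@lebesgue_measure R).

Lemma char_funE (Y : {RV P >-> R}) (u r : R) : char_fun Y u = r%:C%C ->
  E (fun w => cos (u * Y w)) = r /\ E (fun w => sin (u * Y w)) = 0.
Proof. by rewrite /char_fun !unlock => -[]. Qed.

Definition power_integral (f : R -> R) : \bar R :=
  (\int[mu]_x (`|f x| `^ alpha)%:E)%E.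

Lemma random_measure_trig (A : set R) (u : R) : finite_length A ->
  E (fun w => cos (u * Z A w)) = expR (- (fine (mu A) * `|u| `^ alpha)) /\
  E (fun w => sin (u * Z A w)) = 0.
Proof.
move=> fA; apply: char_funE; rewrite (srm_control Z_stable fA).
rewrite powRM ?powR_ge0// -powRrM mulVf ?gt_eqF// powRr1// fine_ge0//.
Qed.

Lemma power_integral_simple (s : {sfun R >-> R}) (r : seq R) : uniq r ->
    0 \notin r -> (forall x, s x != 0 -> s x \in r) ->
  power_integral s =
    (\sum_(z <- r) (`|z| `^ alpha)%:E * mu (s @^-1` [set z]))%E.
Proof.
move=> ur r0 sr; rewrite /power_integral.
transitivity (\int[mu]_x (\sum_(z <- r)
    (`|z| `^ alpha)%:E * (\1_(s @^-1` [set z]) x)%:E))%E.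
  apply: eq_integral => x _; have [sx0|sx0] := eqVneq (s x) 0.
    rewrite sx0 normr0 powR0 ?gt_eqF// big1_seq// => z /andP[_ zr].
    rewrite indicE memNset ?mule0//= => /esym; rewrite sx0 => z0.
    by rewrite -z0 zr in r0.
  rewrite (bigD1_seq (s x))//= ?sr// indicE mem_set// mule1 big1 ?adde0//.
  by move=> z zs; rewrite indicE memNset ?mule0//= => /esym/eqP; exact/negP.
have ms z : measurable (s @^-1` [set z]) by exact: measurable_sfunP.
have msE z : measurable_fun setT (fun x => (\1_(s @^-1` [set z]) x)%:E : \bar R).
  by apply/measurable_EFinP; exact: measurable_indic.
rewrite ge0_integral_sum//.
- apply: eq_bigr => z _; rewrite ge0_integralZl//.
  + by rewrite integral_indic ?setIT//; exact: ms.
  + exact: msE.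
- by move=> z; apply: measurable_funeM; exact: msE.
Qed.

(** The level sets of the nonzero values are disjoint and of finite length, so [Z] is independent on
    them and the exponents add up to the integral of |s|^alpha. *)
Lemma simple_integral_trig (s : {sfun R >-> R}) :
    finite_length (s @^-1` [set~ 0]) ->
  [/\ (power_integral s < +oo)%E,
   E (fun w => cos (simple_integral Z s w)) = expR (- fine (power_integral s)) &
   E (fun w => sin (simple_integral Z s w)) = 0].
Proof.
move=> fs.
(* The value 0 is dropped, since its level set has infinite length. *)
pose S := [seq z <- finmap.enum_fset (fset_set (range s)) | z != 0].
have uS : uniq S by apply: filter_uniq; exact: finmap.fset_uniq.
have S0 : 0 \notin S by rewrite mem_filter eqxx.
have sS x : s x != 0 -> s x \in S.
  move=> sx; rewrite mem_filter sx/=.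
  by have := in_fset_set (fimfunP s) (s x); rewrite [RHS]mem_set//; exists x.
pose u (i : 'I_(size S)) := tnth (in_tuple S) i.
have fA i : finite_length (s @^-1` [set u i]).
  apply: finite_length_sub fs; first exact: measurable_sfunP.
  move=> x /= ->; apply/eqP; apply: contraNneq S0 => <-; exact: mem_tnth.
have tA : trivIset setT (fun i => s @^-1` [set u i]).
  move=> i j _ _ [x [/= ->]].
  have inj : injective u by apply/tuple_uniqP.
  exact: inj.
have IE w : simple_integral Z s w = \sum_i u i * Z (s @^-1` [set u i]) w.
  rewrite /simple_integral fsbig_finite//= (bigID (fun z => z == 0))/= big1 ?add0r.
    by rewrite -big_filter -/S big_tnth.
  by move=> z /eqP ->; rewrite mul0r.
have PE : power_integral s = (\sum_i (`|u i| `^ alpha)%:E * mu (s @^-1` [set u i]))%E.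
  by rewrite (power_integral_simple uS S0 sS) big_tnth.
have term_fin i : ((`|u i| `^ alpha)%:E * mu (s @^-1` [set u i]) =
    (fine (mu (s @^-1` [set u i])) * `|u i| `^ alpha)%:E)%E.
  have mfin : mu (s @^-1` [set u i]) \is a fin_num.
    by rewrite ge0_fin_numE//; exact: (fA i).2.
  by rewrite muleC -{1}(fineK mfin) EFinM.
have [cosE sinE] := independent_trig_sum (srm_scattered Z_stable fA tA)
  (fun i => (random_measure_trig (u i) (fA i)).2).
rewrite PE (eq_bigr _ (fun i _ => term_fin i)) sumEFin; split.
- exact: ltry.
- transitivity (E (fun w => cos (\sum_i u i * Z (s @^-1` [set u i]) w))).
    by apply: eq_Rintegral => w _; rewrite IE.
  rewrite cosE /= -sumrN expR_sum; apply: eq_bigr => i _.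
  exact: (random_measure_trig (u i) (fA i)).1.
- rewrite -[RHS]sinE; apply: eq_Rintegral => w _; by rewrite IE.
Qed.

End StableSimpleIntegral.

(** * Real inequalities for the passage to the limit *)

Section StableIntegralLimit.
Context {R : realType}.
Implicit Types a b x y : R.

(** With e given by (1 + e)^alpha = K, either |a - b| <= e |b| and then |a| <= (1 + e) |b|, or |b| <
    |a - b| / e and then |a| <= (1 + 1/e) |a - b|. This covers alpha < 1, where Minkowski's
    inequality fails. *)
Lemma powR_norm_le_split (alpha K : R) : 0 < alpha -> 1 < K ->
  exists2 C, 0 <= C &
    forall a b, `|a| `^ alpha <= K * `|b| `^ alpha + C * `|a - b| `^ alpha.
Proof.
move=> alpha0 K1; pose k := K `^ alpha^-1; pose e := k - 1.
have K0 : 0 < K by exact: lt_trans K1.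
have k1 : 1 < k.
  have one : (1 : R) `^ alpha^-1 = 1 by rewrite powR1.
  rewrite /k -[ltLHS]one; apply: gt0_ltr_powR => //.
  - by rewrite invr_gt0.
  - by rewrite nnegrE.
  - by rewrite nnegrE ltW.
have e0 : 0 < e by rewrite subr_gt0.
have Kk : K = k `^ alpha by rewrite -powRrM mulVf ?gt_eqF// powRr1// ltW.
exists ((1 + e^-1) `^ alpha); first exact: powR_ge0.
move=> a b; have k0 : 0 <= k by exact/ltW/(lt_trans _ k1).
have c0 : 0 <= 1 + e^-1 by rewrite addr_ge0// invr_ge0 ltW.
have mono x y : 0 <= x -> x <= y -> x `^ alpha <= y `^ alpha.
  move=> x0 xy; apply: ge0_ler_powR => //; first exact: ltW.
  by rewrite nnegrE (le_trans x0).
have ab : `|a| <= `|b| + `|a - b| by rewrite addrC -{1}(subrK b a) ler_normD.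
have [h|h] := leP `|a - b| (e * `|b|).
  rewrite Kk -powRM// -[leLHS]addr0; apply: lerD; last first.
    by rewrite mulr_ge0// powR_ge0.
  apply: mono => //; apply: le_trans ab _.
  by rewrite -lerBrDl (le_trans h)// /e mulrBl mul1r.
rewrite -powRM// -[leLHS]add0r; apply: lerD.
  by rewrite mulr_ge0 ?powR_ge0// ltW.
apply: mono => //; apply: le_trans ab _.
rewrite mulrDl mul1r addrC lerD2l mulrC ler_pdivlMr//.
by rewrite mulrC ltW.
Qed.

(** Meant for the integrals of |s_n|^alpha, |f|^alpha and |f - s_n|^alpha as [x_ n], [x] and [D n].
    The constant C may blow up as K tends to 1, so K is fixed before n grows. *)
Lemma cvg_of_approx_le (x_ D : nat -> R) (x : R) : 0 <= x ->
    (forall n, 0 <= D n) -> D n @[n --> \oo] --> 0 ->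
    (forall K, 1 < K -> exists2 C, 0 <= C & \forall n \near \oo,
      x <= K * x_ n + C * D n /\ x_ n <= K * x + C * D n) ->
  x_ n @[n --> \oo] --> x.
Proof.
move=> x0 D0 cD H; apply/cvgrPdist_le => e e0.
(* This makes k x at most e/4, and C D_n will be at most e/8. The cap 1 controls the terms in k^2;
   the summand 1 covers x = 0. *)
pose k := Num.min 1 (e / (4 * (x + 1))).
have d0 : 0 < 4 * (x + 1) by lra.
have k0 : 0 < k by rewrite lt_min ltr01 divr_gt0.
have k1 : k <= 1 by rewrite ge_min lexx.
have kx : k * (4 * (x + 1)) <= e by rewrite -ler_pdivlMr// ge_min lexx orbT.
have [|C C0 HC] := H (1 + k); first by rewrite ltrDl.
have e1 : 0 < e / (8 * (C + 1)) by rewrite divr_gt0//; lra.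
have /cvgr0Pnorm_lt /(_ _ e1) := cD.
apply: filterS2 HC => n [h1 h2] Dn.
have {}Dn : 8 * (C + 1) * D n <= e.
  rewrite mulrC -ler_pdivlMr; last by lra.
  by rewrite (le_trans (ler_norm _))// ltW.
have := D0 n => Dn0.
have CD : C * D n <= e / 8 by nra.
have h3 : k * x_ n <= k * ((1 + k) * x + C * D n) by rewrite ler_wpM2l// ltW.
have CD0 : 0 <= C * D n by rewrite mulr_ge0.
have h4 : k * (C * D n) <= C * D n by rewrite ler_piMl.
have h5 : k * (k * x) <= k * x by rewrite ler_piMl// mulr_ge0// ltW.
rewrite ler_norml; apply/andP; split; nra.
Qed.

(** Sum-to-product formulas reduce both bounds to continuity of [sin] at 0, taken at (x - y)/2. *)
Lemma trig_unif_continuous (e : R) : 0 < e -> exists2 r, 0 < r &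
  forall x y, `|x - y| < r -> `|cos x - cos y| <= e /\ `|sin x - sin y| <= e.
Proof.
move=> e0; have /cvgrPdist_lt /(_ (e / 2)) := @continuous_sin R 0.
rewrite divr_gt0// => /(_ isT); rewrite sin0 => -[r /= r0 Hr].
exists r => // x y xy.
have hs : `|sin ((x - y) / 2)| <= e / 2.
  have := Hr ((x - y) / 2); rewrite /= !sub0r !normrN => h; apply/ltW/h.
  rewrite normrM (@ger0_norm _ 2^-1)// (le_lt_trans _ xy)// ler_piMr//.
  by rewrite invf_le1 ?ler1n.
pose p := (x + y) / 2; pose q := (x - y) / 2.
have xE : x = p + q by rewrite /p /q; field.
have yE : y = p - q by rewrite /p /q; field.
have bnd z : `|z| <= 1 -> `|2 * (z * sin q)| <= e.
  move=> z1; rewrite !normrM (@ger0_norm _ 2)// mulrC -ler_pdivlMr//.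
  by rewrite (le_trans _ hs)// ler_piMl.
rewrite xE yE; split.
  rewrite (_ : _ - _ = 2 * (- sin p * sin q)).
    by apply: bnd; rewrite normrN sin_max.
  by rewrite cosD cosB; ring.
rewrite (_ : _ - _ = 2 * (cos p * sin q)); first by apply: bnd; exact: cos_max.
by rewrite sinD sinB; ring.
Qed.

End StableIntegralLimit.

(** * Convergence in probability *)

Section ConvergenceInProbability.
Context {R : realType} {d : measure_display} {T : measurableType d}.
Variable P : probability T R.

Local Notation E f := (\int[P]_x f x).

(** On the event |Y_n - Y| >= r, of probability below e/4, the difference is at most 2; elsewhere it
    is at most e/2. *)
Lemma cvg_in_probability_expectation (Y_ : nat -> T -> R) (Y : T -> R) (g : R -> R) :
    (forall n, measurable_fun setT (Y_ n)) -> measurable_fun setT Y ->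
    measurable_fun setT g -> (forall x, `|g x| <= 1) ->
    (forall e, 0 < e -> exists2 r, 0 < r &
      forall x y, `|x - y| < r -> `|g x - g y| <= e) ->
    cvg_in_probability P Y_ Y ->
  E (fun w => g (Y_ n w)) @[n --> \oo] --> E (fun w => g (Y w)).
Proof.
move=> mY_ mY mg g1 gu cY; apply/cvgrPdist_le => e e0.
have [|r r0 gr] := gu (e / 2); first by rewrite divr_gt0.
have bg (X : T -> R) : measurable_fun setT X -> bounded_measurable (fun w => g (X w)).
  move=> mX; split; first exact: measurableT_comp.
  by exists 1 => w.
have := cY _ r0 => /fine_cvg /cvgr0Pnorm_lt /(_ (e / 4)).
rewrite divr_gt0// => /(_ isT); apply: filterS => n.
pose A := [set w | r <= `|Y_ n w - Y w|]; move=> /= PA.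
have {}PA : `|fine (P A)| < e / 4 by [].
have mA : measurable A.
  have m1 : measurable_fun setT (fun w => `|Y_ n w - Y w|).
    by apply: measurableT_comp => //; exact: measurable_funB.
  rewrite (_ : A = (fun w => `|Y_ n w - Y w|) @^-1` `[r, +oo[).
    by rewrite -[X in measurable X]setTI; exact: m1.
  by apply/seteqP; split => w /=; rewrite in_itv/= andbT.
rewrite -expectationB//; [|exact: bg|exact: bg].
have bB : bounded_measurable (fun w => g (Y w) - g (Y_ n w)).
  by apply: bounded_measurableB; exact: bg.
have bA := bounded_measurable_indic mA.
have b2A : bounded_measurable (fun w => 2 * \1_A w + cst (e / 2) w).
  apply: bounded_measurableD; last exact: bounded_measurable_cst.
  by apply: bounded_measurableM => //; exact: bounded_measurable_cst.
have iB := bounded_measurable_integrable P bB.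
apply: le_trans (le_normr_Rintegral measurableT iB) _.
apply: (@le_trans _ _ (E (fun w => 2 * \1_A w + cst (e / 2) w))).
  apply: le_Rintegral => //; [|exact: bounded_measurable_integrable|].
    by have := integrable_norm iB.
  move=> w _ /=; rewrite indicE; have [Aw|nAw] := pselect (A w).
    rewrite mem_set// mulr1 (le_trans (ler_normB _ _))// -[leLHS]addr0 lerD//.
      by rewrite (natrD _ 1 1) lerD.
    by rewrite divr_ge0// ltW.
  rewrite memNset// mulr0 add0r distrC; apply: gr.
  by rewrite ltNge; apply/negP.
rewrite expectation_lin//; last exact: bounded_measurable_cst.
rewrite expectation_cst expectation_indic//.
have : fine (P A) < e / 4 by rewrite (le_lt_trans (ler_norm _)).
lra.
Qed.

Lemma cvg_in_probability_lin (k : R) (X_ Y_ W_ : nat -> T -> R) (X Y W : T -> R) :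
    (forall n, measurable_fun setT (X_ n)) -> measurable_fun setT X ->
    (forall n, measurable_fun setT (Y_ n)) -> measurable_fun setT Y ->
    (forall n, measurable_fun setT (W_ n)) -> measurable_fun setT W ->
    (forall n, {ae P, forall w, W_ n w = k * X_ n w + Y_ n w}) ->
    (forall w, W w = k * X w + Y w) ->
    cvg_in_probability P X_ X -> cvg_in_probability P Y_ Y ->
  cvg_in_probability P W_ W.
Proof.
move=> mX_ mX mY_ mY mW_ mW W_E WE cX cY e e0.
have mdist (U V : T -> R) r : measurable_fun setT U -> measurable_fun setT V ->
    measurable [set w | r <= `|U w - V w|].
  move=> mU mV; have m1 : measurable_fun setT (fun w => `|U w - V w|).
    by apply: measurableT_comp => //; exact: measurable_funB.
  rewrite (_ : mkset _ = (fun w => `|U w - V w|) @^-1` `[r, +oo[).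
    by rewrite -[X in measurable X]setTI; exact: m1.
  by apply/seteqP; split => w /=; rewrite in_itv/= andbT.
(* Then |k| r <= e/2, also for k = 0. *)
pose r := e / (2 * (`|k| + 1)).
have k0 : 0 < `|k| + 1 by rewrite ltr_wpDl.
have r0 : 0 < r by rewrite divr_gt0// mulr_gt0.
have e2 : 0 < e / 2 by rewrite divr_gt0.
have := cvgeD _ (cX _ r0) (cY _ e2); rewrite adde0 => /(_ _ isT) cXY.
apply: (squeeze_cvge _ (cvg_cst 0%E) cXY).
apply: nearW => n; rewrite measure_ge0/=.
have [N [mN N0 subN]] := W_E n.
have mX' := mdist _ _ r (mX_ n) mX; have mY' := mdist _ _ (e / 2) (mY_ n) mY.
have mW' := mdist _ _ e (mW_ n) mW.
apply: (@le_trans _ _ (P (N `|` ([set w | r <= `|X_ n w - X w|] `|`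
    [set w | e / 2 <= `|Y_ n w - Y w|])))).
  apply: le_measure; rewrite ?inE//; first by repeat apply: measurableU.
  move=> w /= ew; have [WN|WN] := pselect (W_ n w = k * X_ n w + Y_ n w); last first.
    by left; apply: subN.
  right; apply: contrapT => /not_orP[/negP/=]; rewrite -ltNge => h1 /negP; rewrite -ltNge => h2.
  move: ew; apply/negP; rewrite -ltNge WN WE.
  rewrite (_ : _ - _ = k * (X_ n w - X w) + (Y_ n w - Y w)); last by ring.
  rewrite (le_lt_trans (ler_normD _ _))// [ltRHS](splitr e) ler_ltD//.
  rewrite normrM (@le_trans _ _ ((`|k| + 1) * r))//.
    by rewrite ler_pM// ?lerDl// ltW.
  by rewrite le_eqVlt /r; apply/orP; left; apply/eqP; field; rewrite gt_eqF.
have mXY : measurable ([set w | r <= `|X_ n w - X w|] `|`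
    [set w | e / 2 <= `|Y_ n w - Y w|]) by exact: measurableU.
apply: le_trans (measureU2 _ mN mXY) _.
rewrite -[leRHS]add0e; apply: leeD; [by rewrite -N0|exact: measureU2].
Qed.

End ConvergenceInProbability.

(** * Characteristic function, linearity and existence of stable integrals *)

Section StableIntegralTheory.
Context {R : realType} {d : measure_display} {T : measurableType d}.
Variables (P : probability T R) (alpha : R) (Z : set R -> {RV P >-> R}).
Hypotheses (alpha_gt0 : 0 < alpha) (Z_stable : stable_random_measure alpha Z).

Local Notation E f := (\int[P]_x f x).
Local Notation mu := (@lebesgue_measure R).
Local Notation pint := (power_integral alpha).

Implicit Types f g h : R -> R.

Lemma measurable_normpow f : measurable_fun setT f ->
  measurable_fun setT (fun x => (`|f x| `^ alpha)%:E).
Proof.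
move=> mf; apply/measurable_EFinP; apply: (measurableT_comp (measurable_powR _)).
exact: measurableT_comp.
Qed.

Lemma power_integral_ge0 f : (0 <= pint f)%E.
Proof. by apply: integral_ge0 => x _; rewrite lee_fin powR_ge0. Qed.

Lemma power_integral_le (K C : R) f g h : 0 <= K -> 0 <= C ->
    measurable_fun setT f -> measurable_fun setT g -> measurable_fun setT h ->
    (forall x, `|f x| `^ alpha <= K * `|g x| `^ alpha + C * `|h x| `^ alpha) ->
  (pint f <= K%:E * pint g + C%:E * pint h)%E.
Proof.
move=> K0 C0 mf mg mh fgh.
have pow0 (g' : R -> R) x : (0 <= (`|g' x| `^ alpha)%:E)%E by rewrite lee_fin powR_ge0.
have [pg ph] := (measurable_normpow mg, measurable_normpow mh).
rewrite /power_integral -!ge0_integralZl_EFin// -ge0_integralD//.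
- apply: ge0_le_integral => //.
  + exact: measurable_normpow.
  + by apply: emeasurable_funD; apply: measurable_funeM.
  + by move=> x _; rewrite -!EFinM -EFinD lee_fin.
- by move=> x _; rewrite mule_ge0.
- exact: measurable_funeM.
- by move=> x _; rewrite mule_ge0.
- exact: measurable_funeM.
Qed.

Lemma power_integral_lin_le k : exists C, forall f g,
    measurable_fun setT f -> measurable_fun setT g ->
    (pint (fun x => k * f x + g x)%R <= C%:E * pint f + C%:E * pint g)%E.
Proof.
(* Any K > 1 would serve here. *)
have [C C0 HC] := powR_norm_le_split alpha_gt0 (ltr1n R 2).
pose D := 2 * `|k| `^ alpha + C.
have D0 : 0 <= D by rewrite addr_ge0// mulr_ge0// powR_ge0.
exists D => f g mf mg; apply: power_integral_le => //.
  by apply: measurable_funD => //; exact: measurable_funM.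
move=> x; apply: le_trans (HC _ (k * f x)) _.
rewrite addrAC subrr add0r normrM powRM//.
have := powR_ge0 (`|f x|) alpha; have := powR_ge0 (`|g x|) alpha.
have := powR_ge0 (`|k|) alpha; rewrite /D; nra.
Qed.

Lemma measurable_simple_integral (s : {sfun R >-> R}) :
  measurable_fun setT (simple_integral Z s).
Proof.
rewrite /simple_integral.
under eq_fun do rewrite fsbig_finite//=.
by apply: measurable_sum => x; exact: measurable_funM.
Qed.

(** Along the simple approximations, convergence in L^alpha moves the exponents and convergence in
    probability moves the expectations. [Y] is any version of the integral, which makes the formula
    available for linear combinations. *)
Lemma is_stable_integral_trig f (Y : {RV P >-> R}) : measurable_fun setT f ->
    is_stable_integral Z alpha f Y ->
  [/\ (pint f < +oo)%E,
   E (fun w => cos (Y w)) = expR (- fine (pint f)) &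
   E (fun w => sin (Y w)) = 0].
Proof.
move=> mf [s [fs sf sY]].
pose D n := pint (fun x => f x - s n x).
have sint n := simple_integral_trig alpha_gt0 Z_stable (fs n).
have ms n : measurable_fun setT (s n) by [].
have mfs n : measurable_fun setT (fun x => f x - s n x) by exact: measurable_funB.
(* Finitely many of the distances [D n] may be infinite. *)
have Dfin : \forall n \near \oo, (D n < +oo)%E.
  have /fine_cvgP[+ _] := sf; apply: filterS => n.
  by rewrite ge0_fin_numE// power_integral_ge0.
have split1 K : 1 < K -> exists2 C, 0 <= C & forall n,
    (pint f <= K%:E * pint (s n) + C%:E * D n)%E /\
    (pint (s n) <= K%:E * pint f + C%:E * D n)%E.
  move=> K1; have [C C0 HC] := powR_norm_le_split alpha_gt0 K1.
  have K0 : 0 <= K by rewrite (le_trans _ (ltW K1)).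
  exists C => // n; split; apply: power_integral_le => //.
  by move=> x; rewrite distrC.
have ffin : (pint f < +oo)%E.
  have [C C0 HC] := split1 2 (ltr1n R 2).
  have [N _ /(_ _ (leqnn N)) DN] := Dfin; apply: le_lt_trans (HC N).1 _.
  have [sN _ _] := sint N.
  have finD (x y : \bar R) : (x < +oo)%E -> (y < +oo)%E -> (2%:E * x + C%:E * y < +oo)%E.
    by move=> xoo yoo; rewrite lte_add_pinfty// lte_mul_pinfty// lee_fin.
  exact: finD sN DN.
have fin g : (pint g < +oo)%E -> pint g \is a fin_num.
  by move=> gfin; rewrite ge0_fin_numE// power_integral_ge0.
have fine_le (K C : R) (x y z : \bar R) : x \is a fin_num -> y \is a fin_num ->
    z \is a fin_num -> (x <= K%:E * y + C%:E * z)%E ->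
    fine x <= K * fine y + C * fine z.
  by case: x y z => [x||] [y||] [z||].
have cvg_pint : fine (pint (s n)) @[n --> \oo] --> fine (pint f).
  apply: (@cvg_of_approx_le _ _ (fine \o D)).
  - by rewrite fine_ge0// power_integral_ge0.
  - by move=> n; rewrite fine_ge0// power_integral_ge0.
  - exact: fine_cvg.
  - move=> K /split1[C C0 HC]; exists C => //; apply: filterS Dfin => n Dn.
    have [sn _ _] := sint n; have [fs' sf'] := HC n.
    split; first exact: fine_le (fin _ ffin) (fin _ sn) (fin _ Dn) fs'.
    exact: fine_le (fin _ sn) (fin _ ffin) (fin _ Dn) sf'.
have mI n : measurable_fun setT (simple_integral Z (s n)).
  exact: measurable_simple_integral.
have mY : measurable_fun setT Y by [].
split => //.
- have : E (fun w => cos (simple_integral Z (s n) w)) @[n --> \oo] --> E (fun w => cos (Y w)).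
    apply: cvg_in_probability_expectation => //.
    - exact: continuous_measurable_fun (@continuous_cos R).
    - exact: cos_max.
    - move=> e /trig_unif_continuous[r r0 H]; exists r => // x y xy.
      by have [] := H x y xy.
  rewrite (_ : (fun _ => _) = (fun n => expR (- fine (pint (s n))))); last first.
    by apply/funext => n; have [] := sint n.
  move=> /cvg_unique; apply => //; apply: continuous_cvg; first exact: continuous_expR.
  exact: cvgN.
- have : E (fun w => sin (simple_integral Z (s n) w)) @[n --> \oo] --> E (fun w => sin (Y w)).
    apply: cvg_in_probability_expectation => //.
    - exact: continuous_measurable_fun (@continuous_sin R).
    - exact: sin_max.
    - move=> e /trig_unif_continuous[r r0 H]; exists r => // x y xy.
      by have [] := H x y xy.
  rewrite (_ : (fun _ => _) = cst 0); last first.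
    by apply/funext => n; have [] := sint n.
  by move=> /cvg_unique; apply => //; exact: cvg_cst.
Qed.

Lemma is_stable_integral0 f : measurable_fun setT f -> pint f = 0%E ->
  is_stable_integral Z alpha f (cst 0 : {RV P >-> R}).
Proof.
move=> mf f0; exists (fun=> cst 0 : {sfun R >-> R}); split.
- move=> n; rewrite (_ : _ @^-1` _ = set0); first exact: finite_length0.
  by apply/seteqP; split => x //=; apply.
- rewrite (_ : (fun _ => _) = cst 0%E); first exact: cvg_cst.
  apply/funext => n; rewrite /= -[RHS]f0; apply: eq_integral => x _.
  by rewrite subr0.
- move=> e e0; rewrite (_ : (fun _ => _) = cst 0%E); first exact: cvg_cst.
  apply/funext => n; rewrite (_ : mkset _ = set0) ?measure0//.
  apply/seteqP; split => w //=; rewrite /simple_integral fsbig1 ?subrr ?normr0.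
    by rewrite leNgt e0.
  by move=> _ [x _ <-]; rewrite mul0r.
Qed.

Lemma is_stable_integral_lin k f g (X Y W : {RV P >-> R}) :
    measurable_fun setT f -> measurable_fun setT g ->
    (forall w, W w = k * X w + Y w) ->
    is_stable_integral Z alpha f X -> is_stable_integral Z alpha g Y ->
  is_stable_integral Z alpha (fun x => k * f x + g x) W.
Proof.
move=> mf mg WE [s [fs sf sX]] [s' [fs' sg s'Y]].
pose r n : {sfun R >-> R} := [the {sfun R >-> R} of (cst k \* s n) \+ s' n].
have rE n x : r n x = k * s n x + s' n x by [].
have fr n : finite_length (r n @^-1` [set~ 0]).
  apply: (@finite_length_sub _ _ (s n @^-1` [set~ 0] `|` s' n @^-1` [set~ 0])).
  - by rewrite -[X in measurable X]setTI; apply: measurable_funPT => //; exact: measurableC.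
  - move=> x /= rx; apply/not_andP => -[sx s'x]; apply: rx.
    by rewrite /= sx s'x mulr0 addr0.
  - exact: finite_lengthU.
exists r; split; first exact: fr.
- have [C HC] := power_integral_lin_le k.
  have lim0 (u : nat -> \bar R) : u n @[n --> \oo] --> 0%E ->
      (C%:E * u n)%E @[n --> \oo] --> 0%E.
    by move=> u0; rewrite -[X in _ --> X](mule0 C%:E); exact: cvgeZl.
  have := cvgeD _ (lim0 _ sf) (lim0 _ sg); rewrite adde0 => /(_ _ isT) lim.
  apply: (squeeze_cvge _ (cvg_cst 0%E) lim).
  apply: nearW => n; rewrite power_integral_ge0/=.
  apply: (le_trans _ (HC _ _ _ _)); [|exact: measurable_funB|exact: measurable_funB].
  rewrite le_eqVlt; apply/orP; left; apply/eqP; apply: eq_integral => x _.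
  by congr (`|_| `^ _)%:E; rewrite /=; ring.
- apply: (@cvg_in_probability_lin _ _ _ _ k (fun n => simple_integral Z (s n))
    (fun n => simple_integral Z (s' n)) _ X Y) => //;
    try by move=> n; exact: measurable_simple_integral.
  by move=> n; exact: (simple_integral_lin (srm_additive Z_stable)).
Qed.

Lemma LfunE f : measurable_fun setT f -> (f \in Lfun mu alpha%:E) = (pint f < +oo)%E.
Proof.
move=> mf; apply/idP/idP => [/andP[_]|pf].
  rewrite inE/= /finite_norm => /(poweR_lty alpha).
  by rewrite poweR_Lnorm ?gt_eqF.
apply/andP; split; first by rewrite inE.
by rewrite inE/= /finite_norm unlock poweR_lty.
Qed.

(* If f had no integral, stable_integral Z alpha f would be 0, and srm_normalized
   would make f null, so that 0 would be an integral after all. *)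
Lemma stable_integral_Lfun f : f \in Lfun mu alpha%:E ->
  is_stable_integral Z alpha f (stable_integral Z alpha f).
Proof.
move=> Lf; have mf : measurable_fun setT f by have /andP[] := Lf; rewrite inE.
apply: xgetPex; apply: contrapT => /forallNP noY.
have := srm_normalized Z_stable Lf => /char_funE[+ _].
rewrite /stable_integral xgetPN//.
rewrite (_ : (fun _ => _) = cst 1); last first.
  by apply/funext => w; rewrite /= mulr0 cos0.
rewrite expectation_cst -[LHS]expR0 => /expR_inj/esym/eqP; rewrite oppr_eq0 => /eqP f0.
apply: (noY (cst 0 : {RV P >-> R})); apply: is_stable_integral0 => //.
have ffin : pint f \is a fin_num.
  by rewrite ge0_fin_numE ?power_integral_ge0// -LfunE.
by rewrite -(fineK ffin) f0.
Qed.

(** An integral of [f] would force the integral of |f|^alpha to be finite, so there is none and the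
    default 0 is taken. *)
Lemma stable_integral_notLfun f : measurable_fun setT f -> f \notin Lfun mu alpha%:E ->
  stable_integral Z alpha f = (cst 0 : {RV P >-> R}).
Proof.
move=> mf; rewrite LfunE// => /negP nLf; apply: xgetPN => Y.
by move=> /(is_stable_integral_trig mf)[].
Qed.

End StableIntegralTheory.

(** * Scaling of Lebesgue measure and of the kernel *)

Section Scaling.
Context {R : realType}.
Local Notation mu := (@lebesgue_measure R).

(** Lebesgue measure is [c] times its image under multiplication by [c]; by uniqueness it suffices
    to compare half-open intervals. *)
Lemma ge0_integral_scale (c : R) (f : R -> \bar R) : 0 < c ->
    measurable_fun setT f -> (forall x, (0 <= f x)%E) ->
  (\int[mu]_x f x = c%:E * \int[mu]_x f (c * x)%R)%E.
Proof.
move=> c0 mf f0.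
have mc : measurable_fun setT (fun x : measurableTypeR R => c * x : measurableTypeR R).
  exact: measurable_funM.
pose mc_mixin := isMeasurableFun.Build _ _ _ _ _ mc.
pose phi : {mfun measurableTypeR R >-> measurableTypeR R} :=
  HB.pack (fun x : measurableTypeR R => c * x) mc_mixin.
pose k : {nonneg R} := NngNum (ltW c0).
rewrite (@eq_measure_integral _ _ _ _ (mscale k (pushforward mu phi))).
  rewrite ge0_integral_mscale// ge0_integral_pushforward//.
move=> A mA _; apply: lebesgue_measure_unique => // _ [[a b] _ <-].
rewrite /mscale/= /pushforward.
rewrite [X in _ = (_ * lebesgue_measure X)%E](_ : _ = `]a / c, b / c]%classic); last first.
  by apply/seteqP; split => x /=; rewrite !in_itv/= ltr_pdivrMr// ler_pdivlMr// mulrC.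
rewrite !lebesgue_measure_itv/= !lte_fin ltr_pM2r ?invr_gt0//.
case: ifPn => _; last by rewrite mule0.
by rewrite -!EFinB -EFinM -mulrBl mulrC divfK// gt_eqF.
Qed.

Lemma pos_powM (c x gamma : R) : 0 < c ->
  pos_pow (c * x) gamma = c `^ gamma * pos_pow x gamma.
Proof.
move=> c0; have -> : pos_pow (c * x) gamma =
    if Num.max x 0 == 0 then 0 else (c * Num.max x 0) `^ gamma.
  rewrite /pos_pow (_ : Num.max (c * x) 0 = c * Num.max x 0).
    by rewrite mulf_eq0 (gt_eqF c0).
  by rewrite maxr_pMr ?mulr0// ltW.
rewrite /pos_pow; case: ifPn => _; first by rewrite mulr0.
by rewrite powRM ?le_max ?lexx ?orbT// ltW.
Qed.

Lemma measurable_pos_pow (gamma : R) : measurable_fun setT (fun x : R => pos_pow x gamma).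
Proof.
(* The indicator enforces the value 0 off the positive half-line, also for gamma = 0, where [powR]
   gives 1. *)
rewrite (_ : (fun _ => _) = (fun x => \1_(`]0, +oo[) x * Num.max x 0 `^ gamma)).
  apply: measurable_funM; first exact: measurable_indic.
  apply: (measurableT_comp (measurable_powR _)).
  exact: measurable_maxr.
apply/funext => x; rewrite /pos_pow indicE mem_setE in_itv/= andbT.
have [x0|x0] := leP x 0; first by rewrite eqxx mul0r.
by rewrite gt_eqF// mul1r.
Qed.

Lemma measurable_tempered_kernel (alpha h m t : R) :
  measurable_fun setT (tempered_kernel alpha h m t).
Proof.
have H (y : R) : measurable_fun setT (fun x : R => expR (- m * Num.max (y - x) 0) *
    pos_pow (y - x) (h - alpha^-1)).
  have my : measurable_fun setT (fun x : R => y - x) by exact: measurable_funB.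
  apply: measurable_funM; last exact: (measurableT_comp (measurable_pos_pow _)).
  apply: (measurableT_comp (@measurable_expR R)).
  by apply: measurable_funM => //; exact: measurable_maxr.
apply: measurable_funB; first exact: H.
by have := H 0; under eq_fun do rewrite sub0r.
Qed.

(** The factor c^(-1/alpha) is kept apart from c^h: it is common to all time points and will cancel
    against the scaling of Lebesgue measure, while h varies with time. *)
Lemma tempered_kernel_scale (alpha h m t c x : R) : 0 < c ->
  tempered_kernel alpha h m (c * t) (c * x) =
  c `^ (- alpha^-1) * (c `^ h * tempered_kernel alpha h (c * m) t x).
Proof.
move=> c0.
have H y : expR (- m * Num.max (c * y) 0) * pos_pow (c * y) (h - alpha^-1) =
    c `^ (- alpha^-1) * (c `^ h *
      (expR (- (c * m) * Num.max y 0) * pos_pow y (h - alpha^-1))).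
  rewrite pos_powM// -[in X in Num.max _ X](mulr0 c) -maxr_pMr ?ltW//.
  rewrite powRD; last by apply/implyP => _; rewrite gt_eqF.
  rewrite (_ : - m * (c * _) = - (c * m) * Num.max y 0); last by ring.
  by ring.
have tx : c * t - c * x = c * (t - x) by ring.
have Nx : - (c * x) = c * (- x) by ring.
rewrite /tempered_kernel tx Nx (H (t - x)) (H (- x)); ring.
Qed.

End Scaling.

(** * Self-similar families of stable integrals *)

Section ScaledStableIntegrals.
Context {R : realType} {d : measure_display} {T : measurableType d}.
Variables (P : probability T R) (alpha : R) (Z : set R -> {RV P >-> R}).
Hypotheses (alpha_gt0 : 0 < alpha) (Z_stable : stable_random_measure alpha Z).

Local Notation E f := (\int[P]_x f x).
Local Notation mu := (@lebesgue_measure R).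
Local Notation pint := (power_integral alpha).

Lemma power_integral_scale (c : R) (f : R -> R) : 0 < c -> measurable_fun setT f ->
  pint f = (c%:E * pint (fun x => f (c * x)%R))%E.
Proof.
move=> c0 mf; apply: (ge0_integral_scale c0 (measurable_normpow _ mf)) => x.
by rewrite lee_fin powR_ge0.
Qed.

Lemma power_integralZ (k : R) (f : R -> R) : measurable_fun setT f ->
  pint (fun x => k * f x) = ((`|k| `^ alpha)%:E * pint f)%E.
Proof.
move=> mf; rewrite /power_integral -ge0_integralZl_EFin ?powR_ge0//.
- by apply: eq_integral => x _; rewrite normrM powRM// EFinM.
- exact: measurable_normpow.
Qed.

(** The power alpha turns c^(-1/alpha) into 1/c, which cancels the Jacobian c. *)
Lemma power_integral_self_similar (c : R) (f g : R -> R) : 0 < c ->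
    measurable_fun setT f -> measurable_fun setT g ->
    (forall x, f (c * x) = c `^ (- alpha^-1) * g x) ->
  pint f = pint g.
Proof.
move=> c0 mf mg fg; rewrite (power_integral_scale c0 mf); under eq_fun do rewrite fg.
rewrite power_integralZ// muleA -EFinM ger0_norm ?powR_ge0// -powRrM mulNr.
rewrite mulVf ?gt_eqF// powRN powRr1 ?ltW// divff ?mul1e// gt_eqF//.
Qed.

Lemma is_stable_integral_sum (I : Type) (r : seq I) (th : I -> R) (f : I -> R -> R)
    (X : I -> {RV P >-> R}) : (forall i, measurable_fun setT (f i)) ->
    (forall i, is_stable_integral Z alpha (f i) (X i)) ->
  exists2 W : {RV P >-> R}, (forall w, W w = \sum_(i <- r) th i * X i w) &
    is_stable_integral Z alpha (fun x => \sum_(i <- r) th i * f i x) W.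
Proof.
move=> mf fX; elim: r => [|i r [W WE fW]].
  exists (cst 0) => [w|]; first by rewrite big_nil.
  apply: is_stable_integral0 => //; first by under eq_fun do rewrite big_nil; exact: measurable_cst.
  rewrite /power_integral integral0_eq// => x _.
  by rewrite big_nil normr0 powR0// gt_eqF.
pose W' : {RV P >-> R} := [the {mfun T >-> R} of (cst (th i) \* X i) \+ W].
exists W' => [w|]; first by rewrite big_cons /= WE.
rewrite (_ : (fun x => _) = (fun x => th i * f i x + \sum_(j <- r) th j * f j x)).
  apply: is_stable_integral_lin fW => //.
  by apply: measurable_sum => j; exact: measurable_funM.
by apply/funext => x; rewrite big_cons.
Qed.

Lemma stable_integral_comb_trig (n : nat) (th : 'I_n -> R) (f : 'I_n -> R -> R)
    (X : 'I_n -> {RV P >-> R}) : (forall i, measurable_fun setT (f i)) ->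
    (forall i, is_stable_integral Z alpha (f i) (X i)) ->
  E (fun w => cos (\sum_(i < n) th i * X i w)) =
    expR (- fine (pint (fun x => \sum_(i < n) th i * f i x))) /\
  E (fun w => sin (\sum_(i < n) th i * X i w)) = 0.
Proof.
move=> mf fX; have [W WE fW] := is_stable_integral_sum (index_enum 'I_n) th mf fX.
have [|_ cosW sinW] := is_stable_integral_trig alpha_gt0 Z_stable _ fW.
  by apply: measurable_sum => j; exact: measurable_funM.
rewrite -cosW -[X in _ /\ _ = X]sinW; split; apply: eq_Rintegral => w _; by rewrite WE.
Qed.

(** An index stands for a time point. [f i], [g i] and [k i] vary freely with [i], as the exponent H
    does with time; only the factor c^(-1/alpha) is shared, so it comes out of every linear
    combination. *)
Lemma stable_integral_self_similar (n : nat) (c : R) (k : 'I_n -> R)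
    (f g : 'I_n -> R -> R) (B : set (n.-tuple R)) : 0 < c -> (forall i, 0 < k i) ->
    (forall i, measurable_fun setT (f i)) -> (forall i, measurable_fun setT (g i)) ->
    (forall i x, f i (c * x) = c `^ (- alpha^-1) * (k i * g i x)) ->
    measurable B ->
  P [set w | B [tuple stable_integral Z alpha (f i) w | i < n]] =
  P [set w | B [tuple k i * stable_integral Z alpha (g i) w | i < n]].
Proof.
move=> c0 k0 mf mg fg mB.
(* Integrability agrees at each index, so the default value 0 occurs on both sides or on neither. *)
have Lfg i : (f i \in Lfun mu alpha%:E) = (g i \in Lfun mu alpha%:E).
  have mkg : measurable_fun setT (fun x => k i * g i x) by exact: measurable_funM.
  rewrite !LfunE// (power_integral_self_similar c0 (mf i) mkg (fg i)) power_integralZ//.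
  have ki : 0 < `|k i| `^ alpha by rewrite powR_gt0// normr_gt0 gt_eqF.
  have := power_integral_ge0 alpha (g i).
  case: (pint (g i)) => [r _|_|//]; first by rewrite !ltry.
  by rewrite gt0_muley// lte_fin.
(* Kernels without an integral contribute the constant 0, hence may be replaced by 0. *)
pose F i x := if f i \in Lfun mu alpha%:E then f i x else 0.
pose G i x := if g i \in Lfun mu alpha%:E then g i x else 0.
have trunc (h : R -> R) : measurable_fun setT h ->
    measurable_fun setT (fun x => if h \in Lfun mu alpha%:E then h x else 0) /\
    is_stable_integral Z alpha (fun x => if h \in Lfun mu alpha%:E then h x else 0)
      (stable_integral Z alpha h).
  move=> mh; case: (boolP (h \in _)) => hL; first by split => //; exact: stable_integral_Lfun.
  split; first exact: measurable_cst.
  rewrite stable_integral_notLfun//; apply: is_stable_integral0 => //.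
  rewrite /power_integral integral0_eq// => x _.
  by rewrite normr0 powR0// gt_eqF.
have mF i := (trunc _ (mf i)).1; have iF i := (trunc _ (mf i)).2.
have mG i := (trunc _ (mg i)).1; have iG i := (trunc _ (mg i)).2.
have FG i x : F i (c * x) = c `^ (- alpha^-1) * (k i * G i x).
  by rewrite /F /G Lfg; case: ifPn => _; rewrite ?fg// !mulr0.
apply: (eq_joint_law (Y := fun w => [tuple stable_integral Z alpha (f i) w | i < n])
  (Y' := fun w => [tuple k i * stable_integral Z alpha (g i) w | i < n])) => //.
- apply/measurable_fun_tnthP => i; rewrite (_ : _ \o _ = stable_integral Z alpha (f i))//.
  by apply/funext => w /=; rewrite tnth_mktuple.
- apply/measurable_fun_tnthP => i.
  rewrite (_ : _ \o _ = (fun w => k i * stable_integral Z alpha (g i) w)).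
    exact: measurable_funM.
  by apply/funext => w /=; rewrite tnth_mktuple.
move=> th.
have dotf w : tuple_dot th [tuple stable_integral Z alpha (f i) w | i < n] =
    \sum_(i < n) th i * stable_integral Z alpha (f i) w.
  by apply: eq_bigr => i _; rewrite tnth_mktuple.
have dotg w : tuple_dot th [tuple k i * stable_integral Z alpha (g i) w | i < n] =
    \sum_(i < n) (th i * k i) * stable_integral Z alpha (g i) w.
  by apply: eq_bigr => i _; rewrite tnth_mktuple mulrA.
have [cf sf] := stable_integral_comb_trig th mF iF.
have [cg sg] := stable_integral_comb_trig (fun i => th i * k i) mG iG.
have Ef (phi : R -> R) : E (fun w => phi (tuple_dot th
    [tuple stable_integral Z alpha (f i) w | i < n])) =
    E (fun w => phi (\sum_(i < n) th i * stable_integral Z alpha (f i) w)).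
  by apply: eq_Rintegral => w _; rewrite dotf.
have Eg (phi : R -> R) : E (fun w => phi (tuple_dot th
    [tuple k i * stable_integral Z alpha (g i) w | i < n])) =
    E (fun w => phi (\sum_(i < n) (th i * k i) * stable_integral Z alpha (g i) w)).
  by apply: eq_Rintegral => w _; rewrite dotg.
split; last exact: etrans (etrans (Ef sin) sf) (esym (etrans (Eg sin) sg)).
apply: etrans (etrans (Ef cos) cf) (etrans _ (esym (etrans (Eg cos) cg))).
congr (expR (- fine _)).
apply: (power_integral_self_similar c0).
- by apply: measurable_sum => i; exact: measurable_funM.
- by apply: measurable_sum => i; exact: measurable_funM.
move=> x; rewrite mulr_sumr; apply: eq_bigr => i _.
by have := FG i x; rewrite /F /G => ->; rewrite mulrCA !mulrA.
Qed.

End ScaledStableIntegrals.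

Theorem proposition5 (R : realType) (d : measure_display)
    (T : measurableType d) (P : probability T R)
    (a b alpha lambda : R) (H : R -> R) (Z : set R -> {RV P >-> R})
    (a_gt0 : 0 < a) (le_ab : a <= b) (b_le2 : b <= 2)
    (H_continuous : continuous H) (H_range : forall t, a <= H t <= b)
    (alpha_gt0 : 0 < alpha) (alpha_le2 : alpha <= 2) (lambda_gt0 : 0 < lambda)
    (Z_stable : stable_random_measure alpha Z) (c : R) (c_gt0 : 0 < c) :
  same_fdd P
    (fun t w => tempered_stable_motion Z (H (c * t)) alpha lambda (c * t) w)
    (fun t w => c `^ H (c * t) *
       tempered_stable_motion Z (H (c * t)) alpha (c * lambda) t w).
Proof.
move=> n t B mB.
(* Once the times are fixed, each H (c t_i) is a mere number, and c^(H (c t_i)) a deterministic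
   positive factor. *)
apply: (stable_integral_self_similar alpha_gt0 Z_stable c_gt0 (k := fun i => c `^ H (c * tnth t i))
  (f := fun i => tempered_kernel alpha (H (c * tnth t i)) lambda (c * tnth t i))
  (g := fun i => tempered_kernel alpha (H (c * tnth t i)) (c * lambda) (tnth t i))) => //.
- by move=> i; exact: powR_gt0.
- by move=> i; exact: measurable_tempered_kernel.
- by move=> i; exact: measurable_tempered_kernel.
- by move=> i x; exact: tempered_kernel_scale.
Qed.
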